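(* For any positive integer $n$, $n$-convexity is a local property: if $I_1,I_2\subseteq\mathbb{R}$ are open intervals with $I_1\cap I_2\neq\emptyset$ and $f:I_1\cup I_2\to\mathbb{R}$ is a function such that $f|_{I_1}$ is $n$-convex on $I_1$ and $f|_{I_2}$ is $n$-convex on $I_2$, then $f$ is $n$-convex on $I_1\cup I_2$.
   Context: For an open interval $I$, a function $f:I\to\mathbb{R}$ is called matrix convex of order $n$ (or $n$-convex) on $I$ if for all $n\times n$ Hermitian matrices $A,B$ with spectra in $I$ and all $\lambda\in[0,1]$ one has $f(\lambda A+(1-\lambda)B)\le\lambda f(A)+(1-\lambda)f(B)$. Here $f(A)$ is defined by the functional calculus, and $X\le Y$ means that $Y-X$ is positive semi-definite. *)

(* Defs.v *)
From mathcomp Require Export all_boot all_order all_algebra.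
From mathcomp Require Export complex.
From mathcomp Require Export boolp classical_sets set_interval reals.
From mathcomp Require Export topology normedtype.

Set Implicit Arguments.
Unset Strict Implicit.
Unset Printing Implicit Defensive.

Import Order.TTheory GRing.Theory Num.Theory numFieldNormedType.Exports.

Local Open Scope ring_scope.
Local Open Scope complex_scope.
Local Open Scope sesquilinear_scope.
Local Open Scope classical_set_scope.

(* Bounded or not: any open subset of the line that is order-convex. *)
Definition open_interval (R : realType) (I : set R) : Prop :=
  is_interval I /\ open I.

Definition spectrum_in (R : realType) (n : nat) (A : 'M[R[i]]_n) (I : set R) :
    Prop :=
  forall z : R[i], eigenvalue A z -> exists2 x : R, I x & z = x%:C.

Definition psdmx (R : realType) (n : nat) (X : 'M[R[i]]_n) : Prop :=
  X \is hermsymmx /\ forall v : 'cV[R[i]]_n, 0 <= (v ^t* *m X *m v) 0 0.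

Definition loewner_le (R : realType) (n : nat) (X Y : 'M[R[i]]_n) : Prop :=
  psdmx (Y - X).

(* Functional calculus.  For Hermitian [A] the library provides
   [A = invmx P *m diag_mx d *m P] with [P := spectralmx A] unitary and the
   entries of [d := spectral_diag A] real (they are the eigenvalues of [A]);
   [f] is applied to these entries.  The value does not depend on the chosen
   diagonalization.  It is meaningful only for Hermitian [A]. *)
Definition funmx (R : realType) (n : nat) (f : R -> R) (A : 'M[R[i]]_n) :
    'M[R[i]]_n :=
  invmx (spectralmx A)
    *m diag_mx (map_mx (fun z : R[i] => (f (complex.Re z))%:C)
                  (spectral_diag A))
    *m spectralmx A.

(* [f] is total, but for [A] with spectrum in [I] the matrix [funmx f A] only
   involves the values of [f] on [I]; so this is a property of the restriction
   of [f] to [I] when [I] is an interval. *)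
Definition matrix_convex (R : realType) (n : nat) (I : set R) (f : R -> R) :
    Prop :=
  forall (A B : 'M[R[i]]_n) (t : R),
    A \is hermsymmx -> B \is hermsymmx ->
    spectrum_in A I -> spectrum_in B I ->
    0 <= t <= 1 ->
    loewner_le (funmx f (t%:C *: A + (1 - t)%:C *: B))
               (t%:C *: funmx f A + (1 - t)%:C *: funmx f B).

(* Main.v *)
Require Import Defs.
From mathcomp Require Import ereal derive measure lebesgue_measure.
From mathcomp Require Import lebesgue_integral ftc.
From mathcomp Require Import ring lra zify.

Set Implicit Arguments.
Unset Strict Implicit.
Unset Printing Implicit Defensive.

Import Order.TTheory GRing.Theory Num.Theory numFieldNormedType.Exports.

Local Open Scope ring_scope.
Local Open Scope complex_scope.
Local Open Scope sesquilinear_scope.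
Local Open Scope classical_set_scope.

(** For a smooth [f], [n]-convexity on [J] is equivalent to a pointwise
    condition: with [a_k = f^(k) / k!], the Hankel matrix [a_(i+j+2)(x)],
    [0 <= i, j < n], is positive semidefinite at every [x] of [J].

    Necessity comes from the second difference of [f] at [t + h X] in the
    direction [h e_0 e_0^T], with [X] the [n x n] Jacobi matrix with
    off-diagonal entries 1, tested on vectors with coordinates of order
    [h^-i]: conjugation by [diag (h^i)] turns [h X] into a perturbation of a
    nilpotent shift, and the Hankel form is the limit as [h -> 0] of the second
    difference divided by [h^2].

    For sufficiency, Rolle's theorem applied to [f q^2] minus its Hermite
    interpolation polynomial, [q] of degree less than [n], shows that the Kraus
    forms [\sum_(x, y) e_x e_y f[mu, x, y]] are nonnegative.  For Hermitian [C]
    and [B], the remainder [f(B) - f(C) - Df(C)(B - C)] is, in eigenbases of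
    [C] and [B], a sum of Kraus forms, so [f] lies above its tangents.

    The Hankel condition being pointwise, smooth [f] are settled.  A Steklov
    average [x |-> h^-1 \int_x^(x+h) f] of an [n]-convex [f] is [n]-convex on a
    slightly smaller interval and gains one derivative; letting [h -> 0]
    transfers the result from [C^(K+1)] to [C^K] functions, down to the
    continuous ones, and [n]-convex functions are continuous. *)

(** * Diagonalization by unitary matrices *)

Section UnitaryDiagonalization.
Variables (C : numClosedFieldType) (n : nat).
Implicit Types (U V A B D : 'M[C]_n) (d e c : 'rV[C]_n) (v : 'cV[C]_n).

Definition udiag U d : 'M[C]_n := U^t* *m diag_mx d *m U.

Lemma unitary_mulVmx U : U \is unitarymx -> U^t* *m U = 1%:M.
Proof. by move=> Uu; rewrite -(invmx_unitary Uu) mulVmx// unitarymx_unit. Qed.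

Lemma udiagE U d i j :
  udiag U d i j = \sum_k Num.conj (U k i) * d 0 k * U k j.
Proof. by rewrite /udiag mul_mx_diag mxE; apply: eq_bigr => k _; rewrite !mxE. Qed.

Lemma udiag_form U d v : (v^t* *m udiag U d *m v) 0 0 =
  \sum_i d 0 i * (Num.conj ((U *m v) i 0) * (U *m v) i 0).
Proof.
have -> : v^t* *m udiag U d *m v = (U *m v)^t* *m diag_mx d *m (U *m v).
  by rewrite /udiag trmx_mul map_mxM !mulmxA.
rewrite mul_mx_diag mxE; apply: eq_bigr => k _.
by rewrite [(\matrix_(_, _) _) _ _]mxE [_^t* _ _]mxE [_^T _ _]mxE mulrCA mulrA.
Qed.

Lemma udiag_herm U d : (forall i, d 0 i \is Num.real) -> udiag U d \is hermsymmx.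
Proof.
move=> dr; apply/is_hermitianmxP; rewrite expr0 scale1r; apply/matrixP=> i j.
rewrite [RHS]mxE [in RHS]mxE !udiagE rmorph_sum; apply: eq_bigr => k _ /=.
by rewrite !rmorphM/= conjCK (CrealP (dr k)) mulrC mulrA mulrAC.
Qed.

Lemma herm_udiag A : A \is hermsymmx ->
  A = udiag (spectralmx A) (spectral_diag A).
Proof.
move=> /hermitian_normalmx/orthomx_spectralP {1}->.
by rewrite /udiag invmx_unitary// spectral_unitarymx.
Qed.

(* The change of basis [U *m V^t*] intertwines the two diagonal matrices, so its
   [(i, j)] entry vanishes unless [d i = e j]. *)
Lemma udiag_map U V d e (f : C -> C) :
  U \is unitarymx -> V \is unitarymx ->
  udiag U d = udiag V e -> udiag U (map_mx f d) = udiag V (map_mx f e).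
Proof.
move=> Uu Vu UV; pose W := U *m V^t*.
have eqW d' e' : diag_mx d' *m W = W *m diag_mx e' -> udiag U d' = udiag V e'.
  move=> /(congr1 (fun X => U^t* *m X *m V)).
  rewrite /W !mulmxA unitary_mulVmx// mul1mx -!mulmxA unitary_mulVmx// mulmx1.
  by rewrite /udiag !mulmxA.
have Weq : diag_mx d *m W = W *m diag_mx e.
  move: UV => /(congr1 (fun X => U *m X *m V^t*)).
  rewrite /udiag !mulmxA (unitarymxP Uu) mul1mx -!mulmxA (unitarymxP Vu) mulmx1.
  by rewrite /W.
apply: eqW; apply/matrixP => i j; move/matrixP/(_ i j): Weq.
have mulEl d' : (diag_mx d' *m W) i j = d' 0 i * W i j.
  by rewrite mul_diag_mx mxE.
have mulEr e' : (W *m diag_mx e') i j = W i j * e' 0 j.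
  by rewrite mul_mx_diag mxE.
rewrite !mulEl !mulEr ![map_mx f _ _ _]mxE.
have [->|w0] := eqVneq (W i j) 0; first by rewrite !mulr0 !mul0r.
by rewrite mulrC => /(mulfI w0) ->; rewrite mulrC.
Qed.

Lemma eigenvalue_udiag U d z : U \is unitarymx ->
  eigenvalue (udiag U d) z -> exists i, z = d 0 i.
Proof.
move=> Uu /eigenvalueP[v vE v0].
have : v *m U^t* != 0.
  apply: contra_neq v0 => /(congr1 (mulmx^~ U)).
  by rewrite -mulmxA unitary_mulVmx// mulmx1 mul0mx.
move=> /rV0Pn [i wi]; exists i.
move: vE => /(congr1 (fun w => (w *m U^t*) 0 i)).
rewrite /udiag !mulmxA -(mulmxA _ U) (unitarymxP Uu) mulmx1.
rewrite mul_mx_diag [X in X = _]mxE -scalemxAl [X in _ = X]mxE mulrC.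
by move=> /(mulIf wi).
Qed.

Lemma udiag_eigenvalue U d i : U \is unitarymx -> eigenvalue (udiag U d) (d 0 i).
Proof.
move=> Uu; apply/eigenvalueP; exists (row i U).
  rewrite /udiag !mulmxA -row_mul (unitarymxP Uu) row1 -rowE.
  by rewrite row_diag_mx -scalemxAl -rowE.
apply/eqP => /(congr1 (mulmx^~ (U^t*))); rewrite -row_mul (unitarymxP Uu) mul0mx.
by move=> /rowP/(_ i); rewrite !mxE eqxx; apply/eqP; exact: oner_neq0.
Qed.

Lemma udiag_const U (x : C) : U \is unitarymx -> udiag U (const_mx x) = x%:M.
Proof.
move=> Uu; rewrite /udiag diag_const_mx.
by rewrite mul_mx_scalar -scalemxAl unitary_mulVmx// scalemx1.
Qed.

Lemma hermsymmxP A : reflect (A = A^t*) (A \is hermsymmx).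
Proof.
by apply: (iffP (is_hermitianmxP _ _ _)) => AE; move: AE; rewrite expr0 scale1r.
Qed.

Lemma hermsymmxD A B : A \is hermsymmx -> B \is hermsymmx -> A + B \is hermsymmx.
Proof.
move=> /hermsymmxP Ah /hermsymmxP Bh; apply/hermsymmxP.
by rewrite {1}Ah {1}Bh linearD/= map_mxD.
Qed.

Lemma hermsymmxB A B : A \is hermsymmx -> B \is hermsymmx -> A - B \is hermsymmx.
Proof.
move=> /hermsymmxP Ah /hermsymmxP Bh; apply/hermsymmxP.
by rewrite {1}Ah {1}Bh linearB/= map_mxB.
Qed.

Lemma hermsymmxZ t A : Num.conj t = t -> A \is hermsymmx -> t *: A \is hermsymmx.
Proof.
move=> tr /hermsymmxP Ah; apply/hermsymmxP.
by rewrite linearZ/= map_mxZ {1}Ah /= tr.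
Qed.

Lemma form_lin s t A B v a b :
  (v^t* *m A *m v) 0 0 = a -> (v^t* *m B *m v) 0 0 = b ->
  (v^t* *m (s *: A + t *: B) *m v) 0 0 = s * a + t * b.
Proof.
move=> <- <-; rewrite mulmxDr mulmxDl -!scalemxAr -!scalemxAl.
by move: (_ *m A *m _) (_ *m B *m _) => x y; rewrite !mxE.
Qed.

Lemma form_sub A B v a b :
  (v^t* *m A *m v) 0 0 = a -> (v^t* *m B *m v) 0 0 = b ->
  (v^t* *m (A - B) *m v) 0 0 = a - b.
Proof.
move=> <- <-; rewrite mulmxBr mulmxBl.
by move: (_ *m A *m _) (_ *m B *m _) => x y; rewrite !mxE.
Qed.

Variables (f : C -> C) (L : C -> C -> C).

(** Daleckii-Krein formula: when [L] is the first divided difference of [f], this is the value at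
    [v] of the derivative of [f] at [udiag U c] in the direction [H]. *)
Definition schur_form U c v (H : 'M[C]_n) : C :=
  \sum_i \sum_j Num.conj ((U *m v) i 0) * (U *m v) j 0 *
    L (c 0 i) (c 0 j) * (U *m H *m U^t*) i j.

Lemma schur_formD U c v (A B : 'M[C]_n) :
  schur_form U c v (A + B) = schur_form U c v A + schur_form U c v B.
Proof.
rewrite /schur_form -big_split/=; apply: eq_bigr => i _.
rewrite -big_split/=; apply: eq_bigr => j _.
by rewrite -mulrDr mulmxDr mulmxDl; congr (_ * _); rewrite [LHS]mxE.
Qed.

Lemma schur_formZ U c v t (A : 'M[C]_n) :
  schur_form U c v (t *: A) = t * schur_form U c v A.
Proof.
rewrite /schur_form mulr_sumr; apply: eq_bigr => i _.
rewrite mulr_sumr; apply: eq_bigr => j _.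
by rewrite mulrCA -scalemxAr -scalemxAl; congr (_ * _); rewrite [LHS]mxE.
Qed.

(** Put [x = U v] and [T = U V^t*]. Then [V v] is the adjoint of [T] applied to [x], and [udiag V e]
    becomes [T diag(e) T^t*] in the basis [U]. For each [k] the remainder of the tangent at
    [udiag U c] is one Kraus form, with [mu = e k] and vector [conj(x i) T i k]. *)
Lemma gradient_identity U c V e v : U \is unitarymx -> V \is unitarymx ->
  \sum_k f (e 0 k) * (Num.conj ((V *m v) k 0) * (V *m v) k 0)
  - \sum_k f (c 0 k) * (Num.conj ((U *m v) k 0) * (U *m v) k 0)
  - schur_form U c v (udiag V e - udiag U c) =
  \sum_k \sum_i \sum_j
    (Num.conj ((U *m v) i 0) * (U *m V^t*) i k) *
    Num.conj (Num.conj ((U *m v) j 0) * (U *m V^t*) j k) *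
    (f (e 0 k) - f (c 0 j) - L (c 0 i) (c 0 j) * (e 0 k - c 0 j)).
Proof.
move=> Uu Vu.
have Vv k : (V *m v) k 0 = \sum_j Num.conj ((U *m V^t*) j k) * (U *m v) j 0.
  have -> : V *m v = (U *m V^t*)^t* *m (U *m v).
    rewrite trmx_mul map_mxM trmxCK !mulmxA -(mulmxA V) unitary_mulVmx//.
    by rewrite mulmx1.
  by rewrite [LHS]mxE; apply: eq_bigr => j _; rewrite [_^t* _ _]mxE [_^T _ _]mxE.
have TT i j : \sum_k (U *m V^t*) i k * Num.conj ((U *m V^t*) j k) = (i == j)%:R.
  have : (U *m V^t*) *m (U *m V^t*)^t* = 1%:M.
    rewrite trmx_mul map_mxM trmxCK !mulmxA -(mulmxA U) unitary_mulVmx//.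
    by rewrite mulmx1 (unitarymxP Uu).
  move=> /matrixP/(_ i j); rewrite [LHS]mxE [RHS]mxE => <-.
  by apply: eq_bigr => k _; rewrite [_^t* _ _]mxE [_^T _ _]mxE.
have UH i j : (U *m (udiag V e - udiag U c) *m U^t*) i j =
    \sum_k (U *m V^t*) i k * Num.conj ((U *m V^t*) j k) * (e 0 k - c 0 j).
  have -> : U *m (udiag V e - udiag U c) *m U^t* =
      (U *m V^t*) *m diag_mx e *m (U *m V^t*)^t* - diag_mx c.
    rewrite mulmxBr mulmxBl /udiag; congr (_ - _).
      by rewrite trmx_mul map_mxM trmxCK !mulmxA.
    by rewrite !mulmxA (unitarymxP Uu) mul1mx -mulmxA (unitarymxP Uu) mulmx1.
  under [RHS]eq_bigr do rewrite mulrBr.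
  rewrite sumrB -mulr_suml TT [LHS]mxE; congr (_ + _).
    rewrite mul_mx_diag [LHS]mxE; apply: eq_bigr => k _.
    by rewrite [(\matrix_(_, _) _) _ _]mxE [_^t* _ _]mxE [_^T _ _]mxE mulrAC.
  rewrite [LHS]mxE [diag_mx _ _ _]mxE.
  by case: eqP => [->|_]; rewrite (mul1r, mul0r) ?mulr1n ?mulr0n.
rewrite /schur_form; move: (U *m _ *m _) (U *m v) (U *m V^t*) UH Vv TT.
move=> H x T UH Vv TT.
have -> : \sum_k f (e 0 k) * (Num.conj ((V *m v) k 0) * (V *m v) k 0) =
    \sum_k \sum_i \sum_j
    Num.conj (x i 0) * x j 0 * (T i k * Num.conj (T j k)) * f (e 0 k).
  apply: eq_bigr => k _ /=.
  rewrite Vv rmorph_sum/= mulr_suml mulr_sumr.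
  apply: eq_bigr => i _; rewrite rmorphM/= conjCK !mulr_sumr.
  by apply: eq_bigr => j _; ring.
(* Summed over [k], [T i k conj(T j k)] is the Kronecker delta, so this term may be spread over [k]
   like the others. *)
have -> : \sum_k f (c 0 k) * (Num.conj (x k 0) * x k 0) = \sum_k \sum_i \sum_j
    Num.conj (x i 0) * x j 0 * (T i k * Num.conj (T j k)) * f (c 0 j).
  rewrite exchange_big/=; apply: eq_bigr => i _ /=.
  rewrite exchange_big/= (bigD1 i)//= [X in _ + X]big1 ?addr0.
    by rewrite -mulr_suml -mulr_sumr TT eqxx mulr1 mulrC.
  move=> j ji; rewrite -mulr_suml -mulr_sumr TT eq_sym (negbTE ji).
  by rewrite mulr0 mul0r.
have -> : \sum_i \sum_j Num.conj (x i 0) * x j 0 * L (c 0 i) (c 0 j) * H i j =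
  \sum_k \sum_i \sum_j
    Num.conj (x i 0) * x j 0 * (T i k * Num.conj (T j k)) *
    (L (c 0 i) (c 0 j) * (e 0 k - c 0 j)).
  rewrite [RHS]exchange_big/=; apply: eq_bigr => i _.
  rewrite [RHS]exchange_big/=; apply: eq_bigr => j _.
  by rewrite UH mulr_sumr; apply: eq_bigr => k _; ring.
rewrite -!sumrB; apply: eq_bigr => k _.
rewrite -!sumrB; apply: eq_bigr => i _.
rewrite -!sumrB; apply: eq_bigr => j _.
by rewrite rmorphM/= conjCK; ring.
Qed.

End UnitaryDiagonalization.

(** * Spectral sums *)

Section SpectralSums.
Variables (R : realType) (n : nat).
Implicit Types (U V W A B : 'M[R[i]]_n) (d e c : 'rV[R]_n) (v : 'cV[R[i]]_n).

Definition normsq (z : R[i]) : R := complex.Re z ^+ 2 + complex.Im z ^+ 2.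

Definition rdiag U d : 'M[R[i]]_n := udiag U (map_mx (real_complex R) d).

(** The quadratic form of f([rdiag U d]) at [v], as a real number; all Loewner inequalities are
    reduced to inequalities between such sums. *)
Definition specsum (f : R -> R) U d v : R :=
  \sum_i f (d 0 i) * normsq ((U *m v) i 0).

Lemma normsq_ge0 z : 0 <= normsq z.
Proof. by rewrite addr_ge0 ?sqr_ge0. Qed.

Lemma normsqE z : (normsq z)%:C = Num.conj z * z.
Proof. by rewrite /normsq add_Re2_Im2 normCKC. Qed.

Lemma specsumE f U d v : (specsum f U d v)%:C =
  \sum_i (f (complex.Re (map_mx (real_complex R) d 0 i)))%:C *
    (Num.conj ((U *m v) i 0) * (U *m v) i 0).
Proof.
rewrite /specsum rmorph_sum; apply: eq_bigr => i _ /=.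
by rewrite rmorphM/= normsqE [map_mx _ _ _ _]mxE.
Qed.

Lemma rdiag_form U d v :
  (v^t* *m rdiag U d *m v) 0 0 = (specsum id U d v)%:C.
Proof.
rewrite /rdiag udiag_form specsumE; apply: eq_bigr => i _.
by rewrite [map_mx _ _ _ _]mxE.
Qed.

Lemma rdiag_herm U d : rdiag U d \is hermsymmx.
Proof.
by apply: udiag_herm => i; rewrite mxE; apply/complex_realP; exists (d 0 i).
Qed.

Lemma map_real_complex f d :
  map_mx (fun z => (f (complex.Re z))%:C) (map_mx (real_complex R) d) =
  map_mx (real_complex R) (map_mx f d).
Proof. by apply/rowP => i; rewrite !mxE. Qed.

Lemma rdiag_map U V d e (f : R -> R) :
  U \is unitarymx -> V \is unitarymx ->
  rdiag U d = rdiag V e -> rdiag U (map_mx f d) = rdiag V (map_mx f e).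
Proof.
move=> Uu Vu UV; have := udiag_map (fun z => (f (complex.Re z))%:C) Uu Vu UV.
by rewrite !map_real_complex.
Qed.

Lemma herm_rdiag A : A \is hermsymmx -> exists2 d, A = rdiag (spectralmx A) d &
  forall f, funmx f A = rdiag (spectralmx A) (map_mx f d).
Proof.
move=> Ah; have AE := herm_udiag Ah.
have /mxOverP dr := hermitian_spectral_diag_real Ah.
have dE : spectral_diag A =
    map_mx (real_complex R) (map_mx (@complex.Re R) (spectral_diag A)).
  by apply/rowP => i; rewrite [RHS]mxE [in RHS]mxE (RRe_real (dr 0 i)).
exists (map_mx (@complex.Re R) (spectral_diag A)); rewrite /rdiag -?dE.
  exact: AE.
move=> f; rewrite -map_real_complex -dE /funmx /udiag.
have := invmx_unitary (spectral_unitarymx A).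
by move: (spectralmx A) => P ->.
Qed.

Lemma funmx_rdiag U d f : U \is unitarymx ->
  funmx f (rdiag U d) = rdiag U (map_mx f d).
Proof.
move=> Uu; have [e AE ->] := herm_rdiag (rdiag_herm U d).
move: (spectralmx _) (spectral_unitarymx (rdiag U d)) AE => P Pu AE.
exact: esym (rdiag_map f Uu Pu AE).
Qed.

Lemma specsum_map f U d v : specsum id U (map_mx f d) v = specsum f U d v.
Proof. by apply: eq_bigr => i _; rewrite [map_mx _ _ _ _]mxE. Qed.

Lemma specsum_eq f U V d e v : U \is unitarymx -> V \is unitarymx ->
  rdiag U d = rdiag V e -> specsum f U d v = specsum f V e v.
Proof.
move=> Uu Vu /(rdiag_map f Uu Vu) UV; rewrite -(specsum_map f U) -(specsum_map f V).
by apply: (@complexI R); rewrite -!rdiag_form UV.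
Qed.

Lemma spectrum_in_rdiag U d (I : set R) : U \is unitarymx ->
  spectrum_in (rdiag U d) I <-> forall i, I (d 0 i).
Proof.
move=> Uu; split=> [h i|h z /(eigenvalue_udiag Uu)[i ->]].
  have := udiag_eigenvalue (map_mx (real_complex R) d) i Uu.
  by move=> /h [x Ix]; rewrite mxE => /complexI ->.
by exists (d 0 i); [exact: h|rewrite mxE].
Qed.

Lemma rdiag_const U (x : R) : U \is unitarymx -> rdiag U (const_mx x) = x%:C%:M.
Proof. by move=> Uu; rewrite /rdiag map_const_mx (udiag_const _ Uu). Qed.

(** Both sides are the squared norm of [v], the form of the identity matrix, which is [rdiag] of the
    constant row 1 in any unitary basis. *)
Lemma specsum1 U V d e v : U \is unitarymx -> V \is unitarymx ->
  specsum (fun=> 1) U d v = specsum (fun=> 1) V e v.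
Proof.
move=> Uu Vu; rewrite -(specsum_map (fun=> 1) U) -(specsum_map (fun=> 1) V).
have const1 d' : map_mx (fun=> 1) d' = const_mx 1 :> 'rV[R]_n.
  by apply/rowP => i; rewrite !mxE.
apply: (specsum_eq _ _ Uu Vu).
by rewrite !const1 (rdiag_const _ Uu) (rdiag_const _ Vu).
Qed.

Lemma specsum_le f U d v (M : R) : (forall i, f (d 0 i) <= M) ->
  specsum f U d v <= M * specsum (fun=> 1) U d v.
Proof.
move=> h; rewrite mulr_sumr; apply: ler_sum => i _.
by rewrite mul1r (ler_wpM2r (normsq_ge0 _)).
Qed.

Lemma specsumN f U d v : specsum (fun x => - f x) U d v = - specsum f U d v.
Proof. by rewrite /specsum -sumrN; apply: eq_bigr => i _; rewrite mulNr. Qed.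

Lemma specsum_ge f U d v (M : R) : (forall i, M <= f (d 0 i)) ->
  M * specsum (fun=> 1) U d v <= specsum f U d v.
Proof.
move=> h; rewrite -lerN2 -specsumN -mulNr; apply: specsum_le => i.
by rewrite lerN2.
Qed.

End SpectralSums.

(** * Matrix convexity in terms of spectral sums, and its derivation from Kraus forms *)

Section SpectralConvexity.
Variables (R : realType) (n : nat).
Implicit Types (U V W A B : 'M[R[i]]_n) (d e c : 'rV[R]_n) (v : 'cV[R[i]]_n).

Definition convex_comb (t : R) U d V e W c : Prop :=
  [/\ U \is unitarymx, V \is unitarymx, W \is unitarymx &
      rdiag W c = t%:C *: rdiag U d + (1 - t)%:C *: rdiag V e].

(** Arbitrary unitary diagonalizations are allowed, not only those chosen by [spectralmx], so that
    explicit matrices and their translates can be plugged in directly. *)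
Definition spectral_convex (I : set R) (f : R -> R) : Prop :=
  forall t U d V e W c v, 0 <= t <= 1 -> convex_comb t U d V e W c ->
    (forall i, I (d 0 i)) -> (forall i, I (e 0 i)) ->
    specsum f W c v <= t * specsum f U d v + (1 - t) * specsum f V e v.

Lemma specsum_convex_comb (f : R -> R) t U d V e W c v :
  U \is unitarymx -> V \is unitarymx -> W \is unitarymx ->
  (v^t* *m (t%:C *: funmx f (rdiag U d) + (1 - t)%:C *: funmx f (rdiag V e)
            - funmx f (rdiag W c)) *m v) 0 0 =
  (t * specsum f U d v + (1 - t) * specsum f V e v - specsum f W c v)%:C.
Proof.
move=> Uu Vu Wu; rewrite (funmx_rdiag _ _ Uu) (funmx_rdiag _ _ Vu) (funmx_rdiag _ _ Wu).
have EU := rdiag_form U (map_mx f d) v.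
have EV := rdiag_form V (map_mx f e) v.
have EW := rdiag_form W (map_mx f c) v.
apply: etrans (form_sub (form_lin t%:C (1 - t)%:C EU EV) EW) _.
by rewrite !specsum_map -!rmorphM -rmorphD -rmorphB.
Qed.

Lemma specsum_id_convex_comb t U d V e W c v : convex_comb t U d V e W c ->
  specsum id W c v = t * specsum id U d v + (1 - t) * specsum id V e v.
Proof.
move=> [Uu Vu Wu WE]; apply: (@complexI R).
have := form_lin t%:C (1 - t)%:C (rdiag_form U d v) (rdiag_form V e v).
by rewrite -WE rdiag_form => ->; rewrite -!rmorphM -rmorphD.
Qed.

Lemma matrix_convexP (I : set R) (f : R -> R) :
  matrix_convex n I f <-> spectral_convex I f.
Proof.
split=> [fcvx t U d V e W c v t01 [Uu Vu Wu WE] dI eI|fcvx A B t Ah Bh AI BI t01].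
  have [] := fcvx _ _ t (rdiag_herm U d) (rdiag_herm V e)
    ((spectrum_in_rdiag d I Uu).2 dI) ((spectrum_in_rdiag e I Vu).2 eI) t01.
  move=> _ /(_ v); rewrite -WE (specsum_convex_comb _ _ _ _ _ _ Uu Vu Wu).
  by rewrite ler0c subr_ge0.
have [d AE _] := herm_rdiag Ah; have [e BE _] := herm_rdiag Bh.
have Ch : t%:C *: A + (1 - t)%:C *: B \is hermsymmx.
  by apply: hermsymmxD; apply: hermsymmxZ => //; exact: conjc_real.
have [c CE _] := herm_rdiag Ch.
have uA := spectral_unitarymx A; have uB := spectral_unitarymx B.
have uC := spectral_unitarymx (t%:C *: A + (1 - t)%:C *: B).
move: (spectralmx A) (spectralmx B) (spectralmx (_ + _)) uA uB uC AE BE CE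
  => U V W uU uV uW AE BE CE.
rewrite {Ah Bh Ch}; subst A B; rewrite /loewner_le CE; split.
  rewrite (funmx_rdiag _ _ uU) (funmx_rdiag _ _ uV) (funmx_rdiag _ _ uW).
  apply: hermsymmxB (rdiag_herm _ _).
  by apply: hermsymmxD; apply: hermsymmxZ; (exact: rdiag_herm || exact: conjc_real).
move=> v; rewrite (specsum_convex_comb _ _ _ _ _ _ uU uV uW) ler0c subr_ge0.
apply: fcvx t01 _ _ _.
- by split; [exact: uU|exact: uV|exact: uW|rewrite CE].
- exact: (spectrum_in_rdiag d I uU).1 AI.
- exact: (spectrum_in_rdiag e I uV).1 BI.
Qed.

(** At a unit eigenvector [v] for [c i], the form of the combination equals [c i]. It is a convex
    combination of the forms of the two other matrices at [v], each of which lies between the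
    extreme eigenvalues of its matrix. *)
Lemma convex_comb_spectrum (I : set R) t U d V e W c : is_interval I ->
  0 <= t <= 1 -> convex_comb t U d V e W c ->
  (forall i, I (d 0 i)) -> (forall i, I (e 0 i)) -> forall i, I (c 0 i).
Proof.
move=> Iitv /andP[t0 t1] WE dI eI i.
have [Uu Vu Wu _] := WE.
pose v : 'cV[R[i]]_n := W^t* *m delta_mx i 0.
have Wv : W *m v = delta_mx i 0 by rewrite mulmxA (unitarymxP Wu) mul1mx.
have sW f : specsum f W c v = f (c 0 i).
  rewrite /specsum Wv (bigD1 i)//= mxE !eqxx/= big1 ?addr0.
    by rewrite /normsq/= expr1n expr0n addr0 mulr1.
  by move=> j ji; rewrite mxE (negbTE ji)/= /normsq/= expr0n/= addr0 mulr0.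
have sU : specsum (fun=> 1) U d v = 1 by rewrite (specsum1 _ c _ Uu Wu) sW.
have sV : specsum (fun=> 1) V e v = 1 by rewrite (specsum1 _ c _ Vu Wu) sW.
have ciE := specsum_id_convex_comb v WE; rewrite sW in ciE.
have [kd _ kdP] := @arg_maxP _ _ _ i xpredT (fun k => d 0 k) isT.
have [ke _ keP] := @arg_maxP _ _ _ i xpredT (fun k => e 0 k) isT.
have [ld _ ldP] := @arg_minP _ _ _ i xpredT (fun k => d 0 k) isT.
have [le _ leP] := @arg_minP _ _ _ i xpredT (fun k => e 0 k) isT.
have u1 : specsum id U d v <= d 0 kd.
  by rewrite -[leRHS]mulr1 -sU; apply: specsum_le => k; exact: kdP.
have u2 : specsum id V e v <= e 0 ke.
  by rewrite -[leRHS]mulr1 -sV; apply: specsum_le => k; exact: keP.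
have l1 : d 0 ld <= specsum id U d v.
  by rewrite -[leLHS]mulr1 -sU; apply: specsum_ge => k; exact: ldP.
have l2 : e 0 le <= specsum id V e v.
  by rewrite -[leLHS]mulr1 -sV; apply: specsum_ge => k; exact: leP.
have Iu := Iitv _ _ (dI ld) (dI kd) (specsum id U d v).
have Iv := Iitv _ _ (eI le) (eI ke) (specsum id V e v).
move: Iu Iv; rewrite u1 u2 l1 l2 => /(_ isT) Iu /(_ isT) Iv.
move: (specsum id U d v) (specsum id V e v) Iu Iv ciE => p q Ip Iq ciE.
have [pq|/ltW qp] := lerP p q.
  by apply: (Iitv _ _ Ip Iq); rewrite ciE; apply/andP; split; nra.
by apply: (Iitv _ _ Iq Ip); rewrite ciE; apply/andP; split; nra.
Qed.

(** Averages two tangent inequalities at the same point: [z] is the value there, [p] and [q] are the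
    linear terms, which cancel. *)
Lemma conv_gradient (t x y z p q : R) : t * p + (1 - t) * q = 0 ->
  0 <= t * (x - z - p) + (1 - t) * (y - z - q) -> z <= t * x + (1 - t) * y.
Proof.
move=> pq0 h; rewrite -subr_ge0.
have <- : t * (x - z - p) + (1 - t) * (y - z - q) = t * x + (1 - t) * y - z.
  transitivity (t * x + (1 - t) * y - z - (t * p + (1 - t) * q)); first by ring.
  by rewrite pq0 subr0.
exact: h.
Qed.

(* The multiplier [L] is arbitrary: its contributions cancel because
   [t (A - C) + (1 - t) (B - C) = 0]. *)
Lemma spectral_convex_of_kraus (f : R -> R) (L : R -> R -> R) (I : set R) :
  is_interval I ->
  (forall c mu (a : 'I_n -> R), (forall i, I (c 0 i)) -> I mu ->
    0 <= \sum_i \sum_j a i * a j *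
      (f mu - f (c 0 j) - L (c 0 i) (c 0 j) * (mu - c 0 j))) ->
  spectral_convex I f.
Proof.
move=> Iitv kraus t U d V e W c v t01 WE dI eI.
have cI := convex_comb_spectrum Iitv t01 WE dI eI.
have {WE} [Uu Vu Wu WE] := WE.
pose LC (z w : R[i]) : R[i] := (L (complex.Re z) (complex.Re w))%:C.
pose ell := schur_form LC W (map_mx (real_complex R) c) v.
(* The function lies above its tangent at [rdiag W c], in the direction of any matrix with spectrum
   in [I]. *)
have key (T : 'M[R[i]]_n) (b : 'rV[R]_n) : T \is unitarymx -> (forall i, I (b 0 i)) ->
    0 <= specsum f T b v - specsum f W c v
    - complex.Re (ell (rdiag T b - rdiag W c)).
  move=> Tu bI.
  have := gradient_identity (fun z => (f (complex.Re z))%:C) LC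
    (map_mx (real_complex R) c) (map_mx (real_complex R) b) v Wu Tu.
  rewrite -!specsumE -/(rdiag _ _) -/ell => /(congr1 (@complex.Re R)).
  rewrite !raddfB/= => ->; rewrite raddf_sum; apply: sumr_ge0 => k _.
  (* The brackets of the Kraus form are real, so only the real part of [p i conj(p j)] counts. It
     splits into the products of real parts and of imaginary parts, giving two real Kraus forms. *)
  pose p i := Num.conj ((W *m v) i 0) * (W *m T^t*) i k.
  have := addr_ge0 (kraus c (b 0 k) (fun i => complex.Re (p i)) cI (bI k))
    (kraus c (b 0 k) (fun i => complex.Im (p i)) cI (bI k)).
  rewrite -big_split/=; congr (0 <= _).
  rewrite raddf_sum; apply: eq_bigr => i _ /=.
  rewrite -big_split raddf_sum/=; apply: eq_bigr => j _.
  rewrite -/(p i) -/(p j) /LC ![map_mx _ _ _ _]mxE/=.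
  rewrite -!rmorphB -rmorphM -rmorphB/=; case: (p i) (p j) => [a1 b1] [a2 b2] /=.
  by ring.
have [t0 t1] := andP t01.
have := addr_ge0 (mulr_ge0 t0 (key _ _ Uu dI))
  (mulr_ge0 (_ : 0 <= 1 - t) (key _ _ Vu eI)).
have FE : t * complex.Re (ell (rdiag U d - rdiag W c)) +
   (1 - t) * complex.Re (ell (rdiag V e - rdiag W c)) = 0.
  have ellE : t%:C * ell (rdiag U d - rdiag W c) +
      (1 - t)%:C * ell (rdiag V e - rdiag W c) = 0.
    rewrite -!schur_formZ -schur_formD WE; move: (rdiag U d) (rdiag V e) => A B.
    have -> : t%:C *: (A - (t%:C *: A + (1 - t)%:C *: B)) +
        (1 - t)%:C *: (B - (t%:C *: A + (1 - t)%:C *: B)) = (0 : R[i]) *: A.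
      by rewrite rmorphB/=; apply/matrixP => i j; rewrite !mxE; ring.
    by rewrite schur_formZ mul0r.
  move: ellE; move: (ell _) (ell _) => [a1 b1] [a2 b2].
  by move=> /(congr1 (@complex.Re R))/=; rewrite !mul0r !subr0.
by rewrite subr_ge0 => /(_ t1); exact: conv_gradient FE.
Qed.

End SpectralConvexity.

(** * Taylor coefficients and zeros *)

Section CauchyProduct.
Variable R : comNzRingType.
Implicit Types u v w : nat -> R.

Definition cauchy u v (k : nat) : R := \sum_(i < k.+1) u i * v (k - i)%N.

Lemma cauchy0 u v : cauchy u v 0%N = u 0%N * v 0%N.
Proof. by rewrite /cauchy big_ord1 subnn. Qed.

Lemma cauchy1 u v : cauchy u v 1%N = u 0%N * v 1%N + u 1%N * v 0%N.
Proof. by rewrite /cauchy big_ord_recr big_ord1. Qed.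

Lemma cauchy_suml (I : Type) (s : seq I) (e : I -> R) (U : I -> nat -> R) v k :
  cauchy (fun j => \sum_(x <- s) e x * U x j) v k =
  \sum_(x <- s) e x * cauchy (U x) v k.
Proof.
rewrite /cauchy; under eq_bigr do rewrite mulr_suml.
rewrite exchange_big/=; apply: eq_bigr => x _.
by rewrite mulr_sumr; apply: eq_bigr => j _; rewrite mulrA.
Qed.

Lemma cauchy_sumr (I : Type) (s : seq I) (e : I -> R) (U : I -> nat -> R) v k :
  cauchy v (fun j => \sum_(x <- s) e x * U x j) k =
  \sum_(x <- s) e x * cauchy v (U x) k.
Proof.
rewrite /cauchy; under eq_bigr do rewrite mulr_sumr.
rewrite exchange_big/=; apply: eq_bigr => x _.
by rewrite mulr_sumr; apply: eq_bigr => j _; rewrite mulrCA.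
Qed.

Lemma cauchy_subr u v w k : cauchy u (fun j => v j - w j) k = cauchy u v k - cauchy u w k.
Proof. by rewrite /cauchy -sumrB; apply: eq_bigr => j _; rewrite mulrBr. Qed.

Lemma cauchy_gt u v (A B k : nat) : (forall j, (A < j)%N -> u j = 0) ->
  (forall j, (B < j)%N -> v j = 0) -> (A + B < k)%N -> cauchy u v k = 0.
Proof.
move=> uA vB ABk; apply: big1 => -[j jk] _ /=.
have [Aj|jA] := ltnP A j; first by rewrite uA// mul0r.
by rewrite vB ?mulr0//; lia.
Qed.

Lemma cauchy_top u v (A B : nat) : (forall j, (A < j)%N -> u j = 0) ->
  (forall j, (B < j)%N -> v j = 0) -> cauchy u v (A + B) = u A * v B.
Proof.
move=> uA vB; have AAB : (A < (A + B).+1)%N by lia.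
rewrite /cauchy (bigD1 (Ordinal AAB))//= addKn big1 ?addr0// => -[j jk].
rewrite -val_eqE/= => jA; have [Aj|j_le] := ltnP A j; first by rewrite uA// mul0r.
by rewrite vB ?mulr0//; lia.
Qed.

Lemma cauchy_low u v (m k : nat) : (forall j, (m <= j)%N -> u j = 0) -> (m <= k.+1)%N ->
  cauchy u v k = \sum_(i < m) u i * v (k - i)%N.
Proof.
move=> um mk; rewrite /cauchy -!(big_mkord xpredT (fun i => u i * v (k - i)%N)).
rewrite (big_cat_nat _ mk)//= [X in _ + X]big1_seq ?addr0// => i.
by rewrite mem_index_iota => /andP[_ /andP[mi _]]; rewrite um// mul0r.
Qed.

End CauchyProduct.

Section TaylorFamilies.
Variable R : realType.
Implicit Types (J : set R) (a b : nat -> R -> R) (p : {poly R}).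

(* [a k] plays the role of the normalized derivative [f^(k) / k!]. *)
Definition taylor_family J (K : nat) a : Prop :=
  forall k x, (k < K)%N -> J x -> is_derive x 1 (a k) (k.+1%:R * a k.+1 x).

Lemma is_derive_ext (f g : R -> R) (x d : R) : (forall y, f y = g y) ->
  is_derive x 1 f d -> is_derive x 1 g d.
Proof. by move=> /funext ->. Qed.

Lemma is_derive_sumr (I : Type) (s : seq I) (h : I -> R -> R) (dh : I -> R) (x : R) :
  (forall i, is_derive x 1 (h i) (dh i)) ->
  is_derive x 1 (fun y => \sum_(i <- s) h i y) (\sum_(i <- s) dh i).
Proof.
move=> hd; elim: s => [|i s IH].
  rewrite big_nil; apply: is_derive_ext (is_derive_cst (0 : R) x 1) => y.
  by rewrite big_nil.
rewrite big_cons; apply: is_derive_ext (is_deriveD (hd i) IH) => y.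
by rewrite big_cons.
Qed.

Lemma taylor_familyB J K a b : taylor_family J K a -> taylor_family J K b ->
  taylor_family J K (fun k x => a k x - b k x).
Proof.
move=> aT bT k x kK Jx; rewrite mulrBr.
exact: (is_deriveB (aT k x kK Jx) (bT k x kK Jx)).
Qed.

Lemma taylor_family_sum J K (I : Type) (s : seq I) (e : I -> R)
    (U : I -> nat -> R -> R) : (forall i, taylor_family J K (U i)) ->
  taylor_family J K (fun k x => \sum_(i <- s) e i * U i k x).
Proof.
move=> UT k x kK Jx; rewrite mulr_sumr.
under eq_bigr do rewrite mulrCA.
apply: is_derive_sumr => i; exact: (is_deriveZ (e i) (UT i k x kK Jx)).
Qed.

(** Leibniz rule, without binomials because the derivatives are normalized. The factor [k + 1] is
    split as [(k + 1 - i) + i], one part for each factor of the [i]-th product. *)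
Lemma taylor_family_cauchy J K a b : taylor_family J K a -> taylor_family J K b ->
  taylor_family J K (fun k x => cauchy (a^~ x) (b^~ x) k).
Proof.
move=> aT bT k x kK Jx.
have -> : k.+1%:R * cauchy (a^~ x) (b^~ x) k.+1 =
    \sum_(i < k.+1) (a i x * ((k - i).+1%:R * b (k - i).+1 x) +
                     b (k - i)%N x * (i.+1%:R * a i.+1 x)).
  have kE (i : 'I_k.+2) : k.+1%:R = (k.+1 - i)%:R + i%:R :> R.
    by rewrite -natrD subnK// -ltnS.
  rewrite big_split/= /cauchy mulr_sumr.
  under [LHS]eq_bigr => i _ do rewrite (kE i) mulrDl.
  rewrite big_split/=; congr (_ + _).
    rewrite big_ord_recr/= subnn mul0r addr0; apply: eq_bigr => -[i ik] _ /=.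
    by rewrite subSn// mulrCA.
  rewrite big_ord_recl/= mul0r add0r; apply: eq_bigr => -[i ik] _ /=.
  by rewrite /bump/= add1n subSS; ring.
apply: is_derive_sumr => -[i ik] /=.
have ai : is_derive x 1 (a i) (i.+1%:R * a i.+1 x) by apply: aT => //; lia.
have bi : is_derive x 1 (b (k - i)%N) ((k - i).+1%:R * b (k - i).+1 x).
  by apply: bT => //; lia.
exact: (is_deriveM ai bi).
Qed.

Lemma is_derive_horner p (x : R) : is_derive x 1 (horner p) (deriv p).[x].
Proof.
apply: DeriveDef; first exact: derivable_horner.
by rewrite derivE -derive1E.
Qed.

Lemma deriv_nderivn p k : deriv (p^`N(k)) = p^`N(k.+1) *+ k.+1.
Proof.
apply/polyP => i; rewrite coef_deriv coefMn !coef_nderivn -!mulrnA addnS addSn.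
congr (_ *+ _); have := mul_bin_left (k + i).+1 k; rewrite subSn ?leq_addr// addKn.
by rewrite mulnC [RHS]mulnC => ->.
Qed.

Lemma taylor_family_poly J K p : taylor_family J K (fun k x => p^`N(k).[x]).
Proof.
move=> k x _ _; have := is_derive_horner (p^`N(k)) x.
by rewrite deriv_nderivn hornerMn mulr_natl.
Qed.

Lemma taylor_family_shift J K a : taylor_family J K.+1 a ->
  taylor_family J K (fun k x => k.+1%:R * a k.+1 x).
Proof. by move=> aT k x kK Jx; exact: (is_deriveZ (k.+1%:R) (aT k.+1 x kK Jx)). Qed.

Lemma MVT_is_derive J (f df : R -> R) (x y : R) : is_interval J -> J x -> J y ->
  x < y -> (forall z, J z -> is_derive z 1 f (df z)) ->
  exists z, [/\ x < z, z < y, J z & f y - f x = df z * (y - x)].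
Proof.
move=> Jitv Jx Jy xy fd.
have Jxy z : x <= z <= y -> J z by exact: Jitv.
have fd' z : z \in `[x, y]%R -> is_derive z 1 f (df z).
  by rewrite in_itv/= => /Jxy/fd.
have fdo z : z \in `]x, y[%R -> is_derive z 1 f (df z).
  by rewrite in_itv/= => /andP[/ltW xz /ltW zy]; apply: fd'; rewrite in_itv/= xz zy.
have fc : {within `[x, y], continuous f}.
  by apply: derivable_within_continuous => z /fd' [].
have [z] := MVT xy fdo fc.
rewrite in_itv/= => /andP[xz zy] E; exists z; split => //.
by apply: Jxy; rewrite !ltW.
Qed.

(** The new zeros lie strictly between consecutive old ones, hence differ from all of them; this
    lets [rolle_double] count them together with the double zeros. *)
Lemma rolle_sorted J (g dg : R -> R) (x : R) (s : seq R) : is_interval J ->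
  (forall z, J z -> is_derive z 1 g (dg z)) ->
  path <%R x s -> (forall z, z \in x :: s -> J z /\ g z = 0) ->
  exists s' : seq R, [/\ uniq s', size s' = size s, all (> x) s',
    forall z, z \in s' -> J z /\ dg z = 0 & forall z, z \in s' -> z \notin x :: s].
Proof.
move=> Jitv gd; elim: s x => [|y s IH] x; first by exists [::].
move=> /= /andP[xy ys] gz.
have [|s' [us' ss' ys' s'z s's]] := IH y ys.
  by move=> z zs; apply: gz; rewrite inE zs orbT.
have [Jx gx] := gz x (mem_head _ _).
have [Jy gy] : J y /\ g y = 0 by apply: gz; rewrite !inE eqxx orbT.
have [z [xz zy Jz]] := MVT_is_derive Jitv Jx Jy xy gd.
rewrite gx gy subrr => /esym/eqP; rewrite mulf_eq0 subr_eq0 (gt_eqF xy) orbF => /eqP dgz.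
have ys_all := order_path_min lt_trans ys.
exists (z :: s'); split => /=.
- rewrite us' andbT; apply/negP => /(allP ys').
  by rewrite ltNge (ltW zy).
- by rewrite ss'.
- rewrite xz; apply/allP => w /(allP ys'); exact: lt_trans.
- by move=> w; rewrite inE => /orP[/eqP->//|/s'z].
- move=> w; rewrite inE => /orP[/eqP ->|ws'].
    rewrite !inE !negb_or (gt_eqF xz) (lt_eqF zy)/=.
    by apply/negP => /(allP ys_all); rewrite ltNge (ltW zy).
  rewrite inE negb_or s's// andbT.
  by rewrite gt_eqF// (lt_trans xy)// (allP ys').
Qed.

Lemma rolle_uniq J (g dg : R -> R) (s : seq R) (k : nat) : is_interval J ->
  (forall z, J z -> is_derive z 1 g (dg z)) ->
  uniq s -> size s = k.+1 -> (forall z, z \in s -> J z /\ g z = 0) ->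
  exists s' : seq R, [/\ uniq s', size s' = k,
    forall z, z \in s' -> J z /\ dg z = 0 & forall z, z \in s' -> z \notin s].
Proof.
move=> Jitv gd us sk gz.
have := sort_lt_sorted s; rewrite us.
have := size_sort <=%R s; have := mem_sort <=%R s; rewrite sk.
case: (sort _ s) => [//|x t] mt [st] xt.
have [|s' [u1 u2 _ u4 u5]] := rolle_sorted Jitv gd xt.
  by move=> z; rewrite mt => /gz.
by exists s'; split => //; [rewrite u2|move=> z /u5; rewrite mt].
Qed.

Lemma rolle_iter J (k K : nat) a (s : seq R) : is_interval J -> taylor_family J K a ->
  (k <= K)%N -> uniq s -> size s = k.+1 -> (forall z, z \in s -> J z /\ a 0%N z = 0) ->
  exists2 xi, J xi & a k xi = 0.
Proof.
move=> Jitv; elim: k K a s => [|k IH] K a s aT kK us sk sz.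
  case: s us sk sz => [//|x s] _ _ sz; have [] := sz x (mem_head _ _).
  by exists x.
case: K aT kK => [//|K] aT kK.
have [s' [us' ss' s'z _]] := rolle_uniq Jitv (fun z => aT 0%N z isT) us sk sz.
have [xi Jxi] := IH _ _ s' (taylor_family_shift aT) kK us' ss' s'z.
move=> /eqP; rewrite mulf_eq0 pnatr_eq0/= => /eqP; by exists xi.
Qed.

(** With [r] double zeros and one simple zero, Rolle's theorem gives [r] zeros of the derivative
    between the nodes. The nodes of [s] give [r] more, and [2r - 1] further applications give a zero
    of order [2r]. *)
Lemma rolle_double J (K : nat) a (mu : R) (s : seq R) : is_interval J ->
  taylor_family J K a -> ((size s).*2 <= K)%N -> uniq (mu :: s) ->
  (forall z, z \in mu :: s -> J z /\ a 0%N z = 0) ->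
  (forall z, z \in s -> a 1%N z = 0) -> exists2 xi, J xi & a (size s).*2 xi = 0.
Proof.
move=> Jitv aT sK us sz sz1.
case: s => [|y s] in sK us sz sz1 *.
  by have [Jmu amu] := sz mu (mem_head _ _); exists mu.
case: K aT sK => [//|K] aT sK.
have [s' [us' ss' s'z s's]] := rolle_uniq Jitv (fun z => aT 0%N z isT) us erefl sz.
(* Here [s] is the tail of the list of double nodes, so there are [(size s).*2.+2] zeros of the
   first derivative. *)
have [|||||xi Jxi] := @rolle_iter J (size s).*2.+1 K
    (fun k x => k.+1%:R * a k.+1 x) (s' ++ y :: s) Jitv.
- exact: taylor_family_shift.
- by move: sK; rewrite /= doubleS.
- move: us; rewrite cons_uniq => /andP[_ us2].
  rewrite cat_uniq us' us2 andbT andTb; apply/hasPn => z zs.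
  by apply/negP => /s's; rewrite inE zs orbT.
- by rewrite size_cat ss' /= addSn addnS addnn.
- move=> z; rewrite mem_cat => /orP[/s'z//|zs].
  have [|Jz _] := sz z; first by rewrite inE zs orbT.
  by rewrite sz1// mulr0.
move=> /eqP; rewrite mulf_eq0 pnatr_eq0/= => /eqP.
by rewrite -doubleS; exists xi.
Qed.

End TaylorFamilies.

(** * Kraus forms *)

Section KrausFromHankel.
Variable R : realType.
Implicit Types (J : set R) (a : nat -> R -> R) (s : seq R).

(** Leading blocks of every size [m <= n] are included: [kraus_distinct] uses the block whose size
    is the number of double nodes. Vectors are sequences on [nat], which serve all sizes at once. *)
Definition hankel_ge0 (n : nat) a (x : R) : Prop :=
  forall m (w : nat -> R), (m <= n)%N ->
    0 <= \sum_(i < m) \sum_(l < m) a (i + l).+2 x * w i * w l.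

Definition ddiff a (x y : R) : R :=
  if x == y then a 1%N x else (a 0%N x - a 0%N y) / (x - y).

(** This is [(mu - x) (mu - y) f[mu, x, y]] for [f = a 0], the numerator of the second divided
    difference. *)
Definition kraus_gap a (mu x y : R) : R :=
  a 0%N mu - a 0%N y - ddiff a x y * (mu - y).

Definition cofactor_poly s (x : R) : {poly R} := \prod_(z <- rem x s) ('X - z%:P).

Lemma nderivn_top (p : {poly R}) k z : (size p <= k.+1)%N -> (p^`N(k)).[z] = p`_k.
Proof.
move=> pk; have -> : p^`N(k) = (p`_k)%:P.
  apply/polyP => i; rewrite coef_nderivn coefC.
  case: i => [|i]; first by rewrite addn0 binn mulr1n.
  by rewrite nth_default ?mul0rn// (leq_trans pk)// addnS ltnS leq_addr.
by rewrite hornerC.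
Qed.

Lemma nderivn_gt (p : {poly R}) k z : (size p <= k)%N -> (p^`N(k)).[z] = 0.
Proof. by move=> pk; rewrite nderivn_poly0// horner0. Qed.

(* With [q = \sum_x e x * p_x], [p_x = cofactor_poly s x], the quadratic form is
   the leading coefficient of the interpolation polynomial of [f q^2] with
   simple node [mu] and double nodes in [s]. *)
Lemma kraus_distinct n J a s (mu : R) (e : R -> R) : is_interval J ->
  taylor_family J n.*2 a -> (forall x, J x -> hankel_ge0 n a x) ->
  uniq (mu :: s) -> (size s <= n)%N -> (forall z, z \in mu :: s -> J z) ->
  0 <= \sum_(x <- s) \sum_(y <- s)
    e x * e y * (kraus_gap a mu x y / ((mu - x) * (mu - y))).
Proof.
move=> Jitv aT aH us sn sJ.
have [s0|s_gt0] := posnP (size s).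
  by rewrite (size0nil s0) big_nil.
have /andP[mus us'] : (mu \notin s) && uniq s by move: us; rewrite cons_uniq.
pose k3 x y := kraus_gap a mu x y / ((mu - x) * (mu - y)).
(* Newton's form of the polynomial interpolating [f] at [x], [y] and [mu], with a double node when
   [x = y]; [k3 x y] is [f[mu, x, y]]. *)
pose N x y : {poly R} := (a 0%N x)%:P + ddiff a x y *: ('X - x%:P)
  + k3 x y *: (('X - x%:P) * ('X - y%:P)).
pose P x k z := ((cofactor_poly s x)^`N(k)).[z].
pose u x y k z := a k z - ((N x y)^`N(k)).[z].
(* The [k]-th Taylor coefficient of the sum of [e x e y p_x p_y (f - N x y)], that is, of [f q^2]
   minus a polynomial of degree at most [2 |s|]. *)
pose G k z := \sum_(x <- s) \sum_(y <- s)
  e x * e y * cauchy (P x ^~ z) (fun j => cauchy (P y ^~ z) (u x y ^~ z) j) k.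
have PT x : taylor_family J n.*2 (P x) by exact: taylor_family_poly.
have uT x y : taylor_family J n.*2 (u x y).
  by apply: taylor_familyB => //; exact: taylor_family_poly.
have GT : taylor_family J n.*2 G.
  have -> : G = (fun k z => \sum_(x <- s) e x * \sum_(y <- s) e y *
      cauchy (P x ^~ z) (fun j => cauchy (P y ^~ z) (u x y ^~ z) j) k).
    apply/funext => k; apply/funext => z; apply: eq_bigr => x _.
    by rewrite mulr_sumr; apply: eq_bigr => y _; rewrite mulrA.
  apply: taylor_family_sum => x; apply: taylor_family_sum => y.
  by apply: taylor_family_cauchy => //; exact: taylor_family_cauchy.
have P0 x z : z \in s -> z != x -> P x 0%N z = 0.
  move=> zs zx; rewrite /P nderivn0; apply/rootP; rewrite root_prod_XsubC.
  by rewrite mem_rem_uniq// inE/= zx.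
have NE x y z : (N x y).[z] =
    a 0%N x + ddiff a x y * (z - x) + k3 x y * ((z - x) * (z - y)).
  by rewrite /N !hornerE.
have u0 x y : u x y 0%N x = 0.
  by rewrite /u nderivn0 NE subrr !mul0r !mulr0 !addr0 subrr.
have u0' x y : u x y 0%N y = 0.
  rewrite /u nderivn0 NE subrr !mulr0 addr0 /ddiff.
  have [->|xy] := eqVneq x y; first by rewrite subrr mulr0 addr0 subrr.
  have xy0 : x - y != 0 by rewrite subr_eq0.
  by field.
have u1 x : u x x 1%N x = 0.
  rewrite /u nderivn1 /N !(derivXsubC, derivC, derivD, derivZ, derivM).
  by rewrite !hornerE /ddiff eqxx /=; ring.
have umu x y : x \in s -> y \in s -> u x y 0%N mu = 0.
  move=> xs ys; rewrite /u nderivn0 NE /k3 /kraus_gap.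
  have mux : mu - x != 0 by rewrite subr_eq0; apply: contraNneq mus => ->.
  have muy : mu - y != 0 by rewrite subr_eq0; apply: contraNneq mus => ->.
  rewrite /ddiff; have [->|xy] := eqVneq x y; first by field.
  have xy0 : x - y != 0 by rewrite subr_eq0.
  by field; rewrite mux muy xy0.
have sK : ((size s).*2 <= n.*2)%N by rewrite leq_double.
have [z zs|z zs|xi Jxi] := rolle_double Jitv GT sK us.
- split; first exact: sJ.
  move: zs; rewrite inE => /orP[/eqP ->|zs].
    apply: big1_seq => x /= xs; apply: big1_seq => y /= ys.
    by rewrite cauchy0 cauchy0 umu// !mulr0.
  apply: big1_seq => x /= xs; apply: big1_seq => y /= ys.
  rewrite cauchy0 cauchy0; have [->|zx] := eqVneq z x; first by rewrite u0 !mulr0.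
  by rewrite P0// mul0r mulr0.
- apply: big1_seq => x /= xs; apply: big1_seq => y /= ys.
  (* At a node [z] the product [p_x p_y u] has a double zero. If [z] differs from [x] and [y], both
     cofactors vanish; if it equals exactly one of them, [u] and one cofactor vanish; if
     [z = x = y], [u] vanishes to second order. *)
  rewrite cauchy1 cauchy0 cauchy1.
  have [->|zx] := eqVneq z x.
    rewrite u0 !mulr0 !addr0.
    have [->|xy] := eqVneq x y; first by rewrite u1 !mulr0.
    by rewrite (P0 y x)// mul0r !mulr0.
  rewrite (P0 x z)// mul0r add0r.
  have [->|zy] := eqVneq z y; first by rewrite u0' !mulr0.
  by rewrite (P0 y z)// mul0r !mulr0.
pose m := (size s).-1; have sm : size s = m.+1 by rewrite /m prednK.
have szP x : x \in s -> size (cofactor_poly s x) = m.+1.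
  by move=> xs; rewrite size_prod_XsubC size_rem// prednK// sm.
have Pgt x j : x \in s -> (m < j)%N -> P x j xi = 0.
  by move=> xs mj; rewrite /P nderivn_gt// szP.
have Ptop x : x \in s -> P x m xi = 1.
  move=> xs; rewrite /P nderivn_top ?szP//.
  have /monicP := monic_prod_XsubC (rem x s) xpredT id.
  by rewrite /lead_coef -/(cofactor_poly s x) szP.
have szXX x y : size (('X - x%:P) * ('X - y%:P) : {poly R}) = 3%N.
  by rewrite size_Mmonic ?monicXsubC ?polyXsubC_eq0// !size_XsubC.
have szlin x y : (size ((a 0%N x)%:P + ddiff a x y *: ('X - x%:P))%R <= 2)%N.
  apply: (leq_trans (size_polyD _ _)); rewrite geq_max; apply/andP; split.
    by rewrite (leq_trans (size_polyC_leq1 _)).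
  by rewrite (leq_trans (size_scale_leq _ _))// size_XsubC.
have szN x y : (size (N x y) <= 3)%N.
  rewrite /N; apply: (leq_trans (size_polyD _ _)); rewrite geq_max.
  by rewrite (leq_trans (szlin x y))// (leq_trans (size_scale_leq _ _))// szXX.
have Ntop x y : ((N x y)^`N(2)).[xi] = k3 x y.
  rewrite nderivn_top// /N coefD (nth_default _ (szlin x y)) add0r coefZ.
  have /monicP : (('X - x%:P) * ('X - y%:P) : {poly R}) \is monic.
    by rewrite monicMl monicXsubC.
  by rewrite /lead_coef szXX/= => ->; rewrite mulr1.
have Ngt x y j : (2 < j)%N -> ((N x y)^`N(j)).[xi] = 0.
  by move=> j2; rewrite nderivn_gt// (leq_trans (szN x y)).
pose Q j := \sum_(x <- s) e x * P x j xi.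
have Qm j : (m < j)%N -> Q j = 0.
  move=> mj; apply: big1_seq => x /= xs; by rewrite Pgt// mulr0.
rewrite sm doubleS => Gxi.
(* Since [G] vanishes at [xi] in index [2 |s|], the coefficient of [f q^2] equals that of the
   polynomial part. Each [p_x] is monic of degree [m] and [N x y] has [k3 x y] in degree 2, so the
   latter is the quadratic form. *)
have <- : cauchy Q (cauchy Q (a ^~ xi)) m.*2.+2 =
    \sum_(x <- s) \sum_(y <- s) e x * e y * k3 x y.
  have QE v k : cauchy Q v k = \sum_(x <- s) e x * cauchy (P x ^~ xi) v k.
    exact: cauchy_suml.
  apply/eqP; rewrite -subr_eq0 -[X in _ == X]Gxi; apply/eqP.
  rewrite QE -sumrB; apply: eq_big_seq => x xs.
  rewrite (_ : cauchy Q _ = fun j => \sum_(y <- s) e y * cauchy (P y ^~ xi) (a ^~ xi) j);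
    last by apply/funext => j; rewrite QE.
  rewrite cauchy_sumr mulr_sumr -sumrB; apply: eq_big_seq => y ys.
  have uE j : cauchy (P y ^~ xi) (u x y ^~ xi) j = cauchy (P y ^~ xi) (a ^~ xi) j -
      cauchy (P y ^~ xi) (fun j => ((N x y)^`N(j)).[xi]) j by exact: cauchy_subr.
  rewrite (funext uE) cauchy_subr.
  rewrite (_ : m.*2.+2 = (m + (m + 2))%N) in Gxi *; last by rewrite -addnn; lia.
  rewrite [in RHS](@cauchy_top _ (P x ^~ xi)
    (cauchy _ (fun j => ((N x y)^`N(j)).[xi])))//; last 2 first.
  - by move=> j; exact: Pgt.
  - by move=> j mj; apply: cauchy_gt mj => j'; [exact: Pgt|exact: Ngt].
  rewrite (@cauchy_top _ (P y ^~ xi) (fun j => ((N x y)^`N(j)).[xi]));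
    [|by move=> j; exact: Pgt|exact: Ngt].
  by rewrite !Ptop// Ntop !mul1r mulrA mulrBr.
rewrite (@cauchy_low _ _ _ m.+1)//; last by lia.
(* The coefficient pairs [Q i * Q l] with [a] of index [2m + 2 - i - l]; reversing both indices
   makes it a Hankel form. *)
have := aH xi Jxi m.+1 (fun i => Q (m - i)%N); rewrite -sm => /(_ sn).
rewrite sm; congr (0 <= _); rewrite (reindex_inj rev_ord_inj)/=.
apply: eq_bigr => -[i im] _ /=; rewrite (@cauchy_low _ _ _ m.+1)//; last by lia.
rewrite mulr_sumr (reindex_inj rev_ord_inj)/=; apply: eq_bigr => -[l lm] _ /=.
rewrite !subSS !subKn// (_ : (m - i + (m - l)).+2 = (m.*2.+2 - i - l)%N); first by ring.
by rewrite -addnn; lia.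
Qed.

(* Equal eigenvalues are merged by adding their weights; the terms with
   eigenvalue [mu] vanish. *)
Lemma kraus_form n J a (c : 'rV[R]_n) (mu : R) (w : 'I_n -> R) : is_interval J ->
  taylor_family J n.*2 a -> (forall x, J x -> hankel_ge0 n a x) ->
  (forall i, J (c 0 i)) -> J mu ->
  0 <= \sum_i \sum_j w i * w j * kraus_gap a mu (c 0 i) (c 0 j).
Proof.
move=> Jitv aT aH cJ Jmu.
pose s := undup (codom (c 0)); pose W x := \sum_(i | c 0 i == x) w i.
have sumW (g : R -> R) : \sum_i w i * g (c 0 i) = \sum_(x <- s) W x * g x.
  under [RHS]eq_bigr do rewrite /W mulr_suml big_mkcond/=.
  rewrite exchange_big/=; apply: eq_bigr => i _; rewrite -big_mkcond/=.
  rewrite (eq_bigl (fun x => x == c 0 i)); last by move=> x; rewrite eq_sym.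
  rewrite (eq_bigr (fun=> w i * g (c 0 i))); last by move=> x /eqP ->.
  rewrite -big_filter filter_pred1_uniq ?undup_uniq ?big_seq1//.
  by rewrite mem_undup codom_f.
have -> : \sum_i \sum_j w i * w j * kraus_gap a mu (c 0 i) (c 0 j) =
    \sum_(x <- s) \sum_(y <- s) W x * W y * kraus_gap a mu x y.
  transitivity (\sum_i w i * \sum_j w j * kraus_gap a mu (c 0 i) (c 0 j)).
    apply: eq_bigr => i _; rewrite mulr_sumr.
    by apply: eq_bigr => j _; rewrite mulrA.
  rewrite (sumW (fun x => \sum_j w j * kraus_gap a mu x (c 0 j))).
  apply: eq_bigr => x _; rewrite (sumW (kraus_gap a mu x)) mulr_sumr.
  by apply: eq_bigr => y _; rewrite mulrA.
have gap_r x : kraus_gap a mu x mu = 0 by rewrite /kraus_gap !subrr mulr0 subrr.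
have gap_l y : kraus_gap a mu mu y = 0.
  rewrite /kraus_gap /ddiff; case: eqVneq => [->|muy]; first by rewrite !subrr mulr0 subrr.
  by rewrite divfK ?subrr// subr_eq0.
(* Away from [mu], the factor [(mu - x) (mu - y)] of the gap moves into the weights and leaves the
   divided difference of [kraus_distinct]. *)
pose t := [seq x <- s | x != mu].
have -> : \sum_(x <- s) \sum_(y <- s) W x * W y * kraus_gap a mu x y =
  \sum_(x <- t) \sum_(y <- t) (W x * (mu - x)) * (W y * (mu - y)) *
    (kraus_gap a mu x y / ((mu - x) * (mu - y))).
  rewrite big_filter [RHS]big_mkcond/=; apply: eq_bigr => x _.
  have [->|xmu] := eqVneq x mu.
    by apply: big1 => y _; rewrite gap_l mulr0.
  rewrite big_filter [RHS]big_mkcond/=; apply: eq_bigr => y _.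
  have [->|ymu] := eqVneq y mu; first by rewrite gap_r mulr0.
  have x0 : mu - x != 0 by rewrite subr_eq0 eq_sym.
  have y0 : mu - y != 0 by rewrite subr_eq0 eq_sym.
  by field; rewrite x0 y0.
apply: (kraus_distinct (fun x => W x * (mu - x)) Jitv aT aH).
- rewrite cons_uniq filter_uniq ?undup_uniq// andbT.
  by rewrite mem_filter eqxx.
- rewrite size_filter (leq_trans (count_size _ _))// (leq_trans (size_undup _))//.
  by rewrite size_codom card_ord.
- move=> z; rewrite inE => /orP[/eqP ->//|].
  by rewrite mem_filter mem_undup => /andP[_ /codomP[i ->]].
Qed.

End KrausFromHankel.

(** * Second differences of matrix powers *)

Section SecondDifference.
Variable A : pzRingType.
Implicit Types C H X Y : A.

Lemma subXX_noncomm X Y k :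
  Y ^+ k - X ^+ k = \sum_(i < k) X ^+ i * (Y - X) * Y ^+ (k.-1 - i).
Proof.
elim: k => [|k IH]; first by rewrite !expr0 subrr big_ord0.
rewrite big_ord_recl/= expr0 mul1r subn0.
have -> : Y ^+ k.+1 - X ^+ k.+1 = (Y - X) * Y ^+ k + X * (Y ^+ k - X ^+ k).
  by rewrite mulrBr mulrBl -!exprS addrA subrK.
congr (_ + _); rewrite IH mulr_sumr; apply: eq_bigr => -[i ik] _ /=.
by rewrite /bump/= add1n exprS !mulrA; congr (_ * _ ^+ _); lia.
Qed.

(** Both [(C + H)^k - C^k] and [(C - H)^k - C^k] telescope; their sum contains differences of powers
    of [C + H] and [C - H], which telescope again. Each term has two explicit factors [H], so a rank
    one [H] splits it into scalars. *)
Lemma second_difference C H k :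
  (C + H) ^+ k + (C - H) ^+ k - C ^+ k *+ 2 =
  (\sum_(i < k) \sum_(j < k.-1 - i)
     C ^+ i * H * (C + H) ^+ j * H * (C - H) ^+ (k.-2 - i - j)) *+ 2.
Proof.
rewrite mulr2n opprD addrACA !subXX_noncomm addrC -big_split -sumrMnl/=.
apply: eq_bigr => -[i ik] _ /=.
rewrite [C + H - C]addrC addKr [C - H - C]addrC addKr mulrN mulNr addrC -mulrBr.
have -> r : (C + H) ^+ r - (C - H) ^+ r =
    (\sum_(j < r) (C + H) ^+ j * H * (C - H) ^+ (r.-1 - j)) *+ 2.
  rewrite -opprB subXX_noncomm -sumrN -sumrMnl; apply: eq_bigr => j _.
  have -> : C - H - (C + H) = - (H *+ 2).
    by rewrite opprD addrACA subrr add0r mulr2n opprD.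
  by rewrite mulrN mulNr opprK mulrnAr mulrnAl.
rewrite mulrnAr mulr_sumr; congr (_ *+ 2); apply: eq_bigr => j _.
rewrite !mulrA; congr (_ * _ ^+ _); lia.
Qed.

End SecondDifference.

(** * Jacobi matrices perturbed at the corner, and their degeneration to a nilpotent shift *)

Section ScaledJacobi.
Variables (T : comNzRingType) (m : nat).
Local Notation N := m.+1.
Implicit Types (z s : T) (w : 'I_N -> T) (B D : 'M[T]_N).

Definition shiftmx : 'M[T]_N := \matrix_(i, j) (i == j.+1 :> nat)%:R.

Definition corner : 'M[T]_N := delta_mx 0 0.

(* [z (shiftmx + shiftmx^T + s corner)] after conjugation by [diag (z ^ i)];
   it degenerates to the nilpotent [shiftmx] at [z = 0]. *)
Definition scaled_jacobi z s : 'M[T]_N :=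
  shiftmx + z ^+ 2 *: shiftmx^T + (z * s) *: corner.

Definition weight_col w B : T := \sum_a w a * B a 0.

(** By [jacobi_second_difference], the second difference of the [k]-th power divided by [2 z^2], in
    a form that still makes sense at [z = 0] and over polynomials in [z]. *)
Definition second_form z w (k : nat) : T :=
  \sum_(i < k) \sum_(j < k.-1 - i)
    weight_col w (scaled_jacobi z 0 ^+ i) * (scaled_jacobi z 1 ^+ j) 0 0 *
    weight_col w (scaled_jacobi z (-1) ^+ (k.-2 - i - j)).

Lemma mul_corner (B D : 'M[T]_N) i j : (B * corner * D) i j = B i 0 * D 0 j.
Proof.
rewrite -!mulmxE /corner -(mul_delta_mx (0 : 'I_1)) mulmxA -colE -mulmxA -rowE.
by rewrite mxE big_ord1 !mxE.
Qed.

Lemma shiftmxX i (a b : 'I_N) : (shiftmx ^+ i) a b = (a == (b + i)%N :> nat)%:R.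
Proof.
elim: i a b => [|i IH] a b; first by rewrite expr0 mxE addn0.
rewrite exprSr -mulmxE mxE.
under eq_bigr do rewrite IH mxE.
have [bN|bN] := ltnP b.+1 N.
  rewrite (bigD1 (Ordinal bN))//= eqxx mulr1 big1 ?addr0.
    by rewrite addSnnS.
  move=> k kb; rewrite [k == _ :> nat](negbTE _) ?mulr0//.
rewrite big1.
  by rewrite (_ : _ == _ = false)//; apply/eqP => /=; have := ltn_ord a; lia.
move=> k _; rewrite (_ : (k == b.+1 :> nat) = false) ?mulr0//.
by apply/eqP; have := ltn_ord k; lia.
Qed.

Lemma scaled_jacobi0 s : scaled_jacobi 0 s = shiftmx.
Proof. by rewrite /scaled_jacobi expr0n mul0r !scale0r !addr0. Qed.

(** At [z = 0] the [i]-th power of the shift sends the first basis vector to the [i]-th one, or to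
    0, and its corner entry vanishes unless [i = 0]. Hence only [j = 0] survives;
    [oapp w 0 (insub i)] is [w] extended by zero. *)
Lemma second_form0 w k :
  second_form 0 w k.+2 = cauchy (fun i => oapp w 0 (insub i)) (fun i => oapp w 0 (insub i)) k.
Proof.
have wcE i : weight_col w (shiftmx ^+ i) = oapp w 0 (insub i).
  rewrite /weight_col; under eq_bigr do rewrite shiftmxX add0n.
  case: insubP => [a _ ai|iN] /=.
    rewrite (bigD1 a)//= ai eqxx mulr1 big1 ?addr0// => b ba.
    rewrite -ai (_ : (b == a :> nat) = false) ?mulr0//.
    by apply/negbTE; move: ba; rewrite -val_eqE.
  apply: big1 => b _; rewrite (_ : (b == i :> nat) = false) ?mulr0//.
  by apply: contraNF iN => /eqP <-.
rewrite /second_form /cauchy !scaled_jacobi0 big_ord_recr/= subnn big_ord0 addr0.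
apply: eq_bigr => -[i ik] _ /=; rewrite subSn; last by lia.
rewrite big_ord_recl/= big1 ?addr0.
  by rewrite !wcE expr0 mxE eqxx mulr1 subn0.
by move=> [j jk] _ /=; rewrite shiftmxX/= mulr0 mul0r.
Qed.

End ScaledJacobi.

Section MapScaledJacobi.
Variables (T T' : comNzRingType) (phi : {rmorphism T -> T'}) (m : nat).

Lemma map_scaled_jacobi z s :
  map_mx phi (scaled_jacobi m z s) = scaled_jacobi m (phi z) (phi s).
Proof.
rewrite /scaled_jacobi /corner !map_mxD !map_mxZ rmorphM rmorphXn/= map_delta_mx.
have sE : map_mx phi (shiftmx T m) = shiftmx T' m.
  by apply/matrixP => i j; rewrite !mxE rmorph_nat.
by rewrite -map_trmx sE.
Qed.

(** Used for evaluation of polynomials: [second_form h] is the value at [h] of [second_form 'X]. *)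
Lemma map_second_form z (w : 'I_m.+1 -> T) k :
  phi (second_form z w k) = second_form (phi z) (phi \o w) k.
Proof.
have XE s i a b : phi ((scaled_jacobi m z s ^+ i) a b) =
    (scaled_jacobi m (phi z) (phi s) ^+ i) a b.
  by rewrite -map_scaled_jacobi -(rmorphXn (map_mx phi)) mxE.
rewrite /second_form rmorph_sum; apply: eq_bigr => i _.
rewrite rmorph_sum; apply: eq_bigr => j _ /=.
rewrite !rmorphM/= !rmorph_sum XE rmorph1; congr (_ * _ * _); apply: eq_bigr => a _.
  by rewrite rmorphM/= XE rmorph0.
by rewrite rmorphM/= XE rmorphN1.
Qed.

End MapScaledJacobi.

Section JacobiForm.
Variables (F : fieldType) (m : nat).
Local Notation N := m.+1.

Definition jacobi : 'M[F]_N := shiftmx F m + (shiftmx F m)^T.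

Definition scaled_col (h : F) (w : 'I_N -> F) : 'cV[F]_N := \col_i (h ^- i * w i).

(** Entrywise form of the intertwining by [S = diag(h^j)], which holds for the matrices and so for
    their powers. *)
Lemma jacobi_conj (h s : F) (i : nat) (a b : 'I_N) : h != 0 ->
  ((h *: (jacobi + s *: corner F m)) ^+ i) a b * h ^+ b =
  h ^+ a * ((scaled_jacobi m h s) ^+ i) a b.
Proof.
move=> h0; pose S : 'M[F]_N := diag_mx (\row_j h ^+ j).
have SE : h *: (jacobi + s *: corner F m) * S = S * scaled_jacobi m h s.
  rewrite -!mulmxE /S; apply/matrixP => p q; rewrite mul_mx_diag mul_diag_mx !mxE.
  have ord0F (r : 'I_N) r' : r = r'.+1 :> nat -> (r == 0) = false.
    by move=> rE; apply/eqP => r0; move: rE; rewrite r0.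
  have [pq|pq] := eqVneq (p : nat) q.+1.
    have qp : (q == p.+1 :> nat) = false by apply/eqP; lia.
    by rewrite qp (ord0F _ _ pq) pq !exprS/=; ring.
  have [qp|qp] := eqVneq (q : nat) p.+1.
    by rewrite (ord0F _ _ qp) andbF qp !exprS/=; ring.
  have [/andP[/eqP -> /eqP ->]|_] := boolP ((p == 0) && (q == 0)).
    by rewrite !expr0/=; ring.
  by rewrite /=; ring.
have SX : (h *: (jacobi + s *: corner F m)) ^+ i * S = S * scaled_jacobi m h s ^+ i.
  elim: i => [|i IH]; first by rewrite !expr0 mul1r mulr1.
  by rewrite exprSr -mulrA SE mulrA IH -mulrA -exprSr.
move/matrixP/(_ a b): SX; rewrite -!mulmxE /S mul_mx_diag mul_diag_mx !mxE.
by [].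
Qed.

(** The corner has rank one, so each term of [second_difference] is a product of a column sum, a
    corner entry and a row sum. Symmetry turns the row into a column, and the powers of [h] from
    [jacobi_conj] cancel those of [scaled_col]. *)
Lemma jacobi_second_difference (h : F) w k : h != 0 ->
  ((scaled_col h w)^T *m
    ((h *: (jacobi + corner F m)) ^+ k + (h *: (jacobi - corner F m)) ^+ k
      - (h *: jacobi) ^+ k *+ 2) *m
    scaled_col h w) 0 0 = (h ^+ 2 * second_form h w k) *+ 2.
Proof.
move=> h0; rewrite scalerDr scalerBr.
set C := h *: jacobi; set H := h *: corner F m; rewrite second_difference.
have EX s i a : ((h *: (jacobi + s *: corner F m)) ^+ i) a 0 =
    h ^+ a * ((scaled_jacobi m h s) ^+ i) a 0.
  by rewrite -jacobi_conj// expr0 mulr1.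
have C0 : C = h *: (jacobi + 0 *: corner F m) by rewrite scale0r addr0.
have Cp : C + H = h *: (jacobi + 1 *: corner F m) by rewrite scale1r scalerDr.
have Cm : C - H = h *: (jacobi + -1 *: corner F m) by rewrite scaleN1r scalerBr.
have trX (D : 'M[F]_N) i : (D ^+ i)^T = D^T ^+ i.
  elim: i => [|i IH]; first by rewrite !expr0 -idmxE trmx1.
  by rewrite exprS exprSr -mulmxE trmx_mul IH.
have trJ s i : ((h *: (jacobi + s *: corner F m)) ^+ i)^T =
    (h *: (jacobi + s *: corner F m)) ^+ i.
  rewrite trX; congr (_ ^+ i); apply/matrixP => p q.
  by rewrite !mxE [X in h * (X + _)]addrC andbC.
have colE s i : \sum_a (scaled_col h w)^T 0 a *
    ((h *: (jacobi + s *: corner F m)) ^+ i) a 0 = weight_col w (scaled_jacobi m h s ^+ i).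
  apply: eq_bigr => a _; rewrite !mxE EX mulrA (mulrC (h ^- a)) -(mulrA (w a)).
  by rewrite mulVf ?mulr1// expf_neq0.
have formE (D : 'M[F]_N) (v : 'cV[F]_N) :
    (v^T *m D *m v) 0 0 = \sum_b \sum_a v a 0 * D a b * v b 0.
  rewrite mxE; apply: eq_bigr => b _; rewrite mxE mulr_suml.
  by apply: eq_bigr => a _; rewrite mxE.
rewrite mulr2n mulmxDr mulmxDl [LHS]mxE -mulr2n; congr (_ *+ 2).
rewrite mulmx_sumr mulmx_suml summxE /second_form mulr_sumr; apply: eq_bigr => i _.
rewrite mulmx_sumr mulmx_suml summxE mulr_sumr; apply: eq_bigr => j _.
set D := _ ^+ (_ - _ - _).
have DE : C ^+ i * H * (C + H) ^+ j * H * D =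
    h ^+ 2 *: (C ^+ i * corner F m * ((C + H) ^+ j * corner F m * D)).
  by rewrite /H -!(scalerAr, scalerAl) scalerA -expr2 !mulrA.
rewrite DE -scalemxAr -scalemxAl [LHS]mxE; congr (_ * _).
rewrite formE.
transitivity (\sum_b \sum_a (scaled_col h w a 0 * (C ^+ i) a 0) *
    ((C + H) ^+ j) 0 0 * (D^T b 0 * scaled_col h w b 0)).
  apply: eq_bigr => b _; apply: eq_bigr => a _.
  by rewrite !mul_corner [D^T _ _]mxE; ring.
rewrite exchange_big/=.
under eq_bigr do rewrite -mulr_sumr.
rewrite -mulr_suml -mulr_suml; congr (_ * _ * _).
- by rewrite -colE -C0; apply: eq_bigr => a _; rewrite [_^T 0 a]mxE.
- by rewrite Cp EX expr0 mul1r.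
- by rewrite -colE /D Cm trJ; apply: eq_bigr => a _; rewrite [_^T 0 a]mxE mulrC.
Qed.

End JacobiForm.

(** * Moments and Taylor expansions *)

Section UdiagPowers.
Variables (C : numClosedFieldType) (m : nat).
Local Notation N := m.+1.
Implicit Types (U : 'M[C]_N) (d e : 'rV[C]_N).

Lemma udiagM U d e : U \is unitarymx ->
  udiag U d * udiag U e = udiag U (\row_i (d 0 i * e 0 i)).
Proof.
move=> Uu; rewrite -!mulmxE /udiag !mulmxA -(mulmxA _ U (U^t*)) (unitarymxP Uu).
rewrite mulmx1 -(mulmxA _ (diag_mx d)); congr (_ *m _ *m _).
by rewrite mulmx_diag.
Qed.

Lemma udiagX U d k : U \is unitarymx ->
  udiag U d ^+ k = udiag U (map_mx (fun z => z ^+ k) d).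
Proof.
move=> Uu; elim: k => [|k IH].
  rewrite expr0 -idmxE -(udiag_const 1 Uu); congr udiag.
  by apply/rowP => i; rewrite !mxE expr0.
rewrite exprS IH (udiagM _ _ Uu); congr udiag.
by apply/rowP => i; rewrite !mxE exprS.
Qed.

Lemma udiag_affine U d s t : U \is unitarymx ->
  udiag U (\row_i (s + t * d 0 i)) = s%:M + t *: udiag U d.
Proof.
move=> Uu; rewrite -(udiag_const s Uu) /udiag scalemxAl scalemxAr -mulmxDl -mulmxDr.
congr (_ *m _ *m _); apply/matrixP => i j; rewrite !mxE.
by case: eqP => _; rewrite ?mulr1n// mulr0n mulr0 addr0.
Qed.

Variables (F : comNzRingType) (phi : {rmorphism F -> C}).
Hypothesis phi_real : forall x, Num.conj (phi x) = phi x.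

Lemma form_map_real (M : 'M[F]_N) (v : 'cV[F]_N) :
  ((map_mx phi v)^t* *m map_mx phi M *m map_mx phi v) 0 0 =
  phi ((v^T *m M *m v) 0 0).
Proof.
have -> : (map_mx phi v)^t* = map_mx phi v^T.
  by apply/matrixP => i j; rewrite !mxE phi_real.
by rewrite -!map_mxM [LHS]mxE.
Qed.

Lemma herm_map_real (M : 'M[F]_N) : M^T = M -> map_mx phi M \is hermsymmx.
Proof.
move=> Ms; apply/hermsymmxP; apply/matrixP => i j.
by rewrite -{1}Ms !mxE phi_real.
Qed.

Lemma udiag_moment U d (M : 'M[F]_N) (v : 'cV[F]_N) k : U \is unitarymx ->
  map_mx phi M = udiag U d ->
  ((map_mx phi v)^t* *m udiag U (map_mx (fun z => z ^+ k) d) *m map_mx phi v) 0 0 =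
  phi ((v^T *m M ^+ k *m v) 0 0).
Proof.
by move=> Uu ME; rewrite -(udiagX _ _ Uu) -ME -(rmorphXn (map_mx phi)) form_map_real.
Qed.

Lemma map_affine U d (M : 'M[F]_N) (s t : F) : U \is unitarymx ->
  map_mx phi M = udiag U d ->
  udiag U (\row_i (phi s + phi t * d 0 i)) = map_mx phi (s%:M + t *: M).
Proof.
by move=> Uu ME; rewrite (udiag_affine _ _ _ Uu) map_mxD map_mxZ map_scalar_mx ME.
Qed.

End UdiagPowers.

Section RealMatrices.
Variables (R : realType) (m : nat).
Local Notation N := m.+1.
Implicit Types (U : 'M[R[i]]_N) (d : 'rV[R]_N) (M : 'M[R]_N) (v : 'cV[R]_N).

Lemma real_sym_rdiag M : M^T = M -> exists U d,
  U \is unitarymx /\ map_mx (real_complex R) M = rdiag U d.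
Proof.
move=> /(herm_map_real (phi := real_complex R) (@conjc_real R))/herm_rdiag[d ME _].
by exists (spectralmx (map_mx (real_complex R) M)), d; split; [exact: spectral_unitarymx|].
Qed.

(** Polynomials are thus evaluated through powers of [M], without computing eigenvalues. *)
Lemma specsum_moment U d M v k : U \is unitarymx ->
  map_mx (real_complex R) M = rdiag U d ->
  specsum (fun x => x ^+ k) U d (map_mx (real_complex R) v) =
  (v^T *m M ^+ k *m v) 0 0.
Proof.
move=> Uu ME.
have dE : map_mx (fun z => z ^+ k) (map_mx (real_complex R) d) =
    map_mx (real_complex R) (map_mx (fun x => x ^+ k) d).
  by apply/rowP => i; rewrite !mxE rmorphXn.
have form1 := udiag_moment (phi := real_complex R) (@conjc_real R) v k Uu ME.
have form2 := rdiag_form U (map_mx (fun x => x ^+ k) d) (map_mx (real_complex R) v).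
rewrite /rdiag -dE specsum_map in form2.
by move: (etrans (esym form2) form1) => /complexI.
Qed.

Lemma rdiag_affine U d M (s t : R) : U \is unitarymx ->
  map_mx (real_complex R) M = rdiag U d ->
  rdiag U (\row_i (s + t * d 0 i)) = map_mx (real_complex R) (s%:M + t *: M).
Proof.
move=> Uu ME; apply: etrans (map_affine (phi := real_complex R) s t Uu ME).
rewrite /rdiag; congr udiag; apply/rowP => i.
by rewrite [LHS]mxE [in LHS]mxE [RHS]mxE [in RHS]mxE rmorphD rmorphM.
Qed.

End RealMatrices.

Section TaylorPeano.
Variable R : realType.
Implicit Types (J : set R) (a : nat -> R -> R).

(** Induction on [K], starting from continuity: the remainder vanishes at [t], its derivative is the
    remainder of the shifted family, and the mean value theorem contributes one more factor
    [|x - t|]. *)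
Lemma taylor_peano J K a (t : R) : open J -> is_interval J ->
  taylor_family J K.+1 a -> J t -> forall e : R, 0 < e -> exists2 dl : R, 0 < dl &
  forall x, `|x - t| < dl -> J x /\
    `|a 0%N x - \sum_(k < K.+1) a k t * (x - t) ^+ k| <= e * `|x - t| ^+ K.
Proof.
move=> Jo Jitv; have nJ x : J x -> \forall y \near x, J y.
  by move=> Jx; exact: open_nbhs_nbhs.
elim: K a => [|K IH] a aT Jt e e0.
  have [d1 d10 Hd1] : exists2 d : R, 0 < d & forall x, `|x - t| < d -> J x.
    have /nbhs_ballP[d /= d0 Hd] := nJ t Jt; exists d => // x xt; apply: Hd.
    by rewrite /ball/= distrC.
  have : {for t, continuous (a 0%N)}.
    by apply/differentiable_continuous/derivable1_diffP; have [] := aT 0%N t isT Jt.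
  move=> /cvgrPdist_le/(_ e e0)/nbhs_ballP[d2 /= d20 Hd2].
  exists (Num.min d1 d2); first by rewrite lt_min d10.
  move=> x; rewrite lt_min => /andP[x1 x2]; split; first exact: Hd1.
  rewrite big_ord1 /= !expr0 !mulr1 distrC; apply: Hd2.
  by rewrite /ball/= distrC.
have [dl dl0 Hdl] := IH _ (taylor_family_shift aT) Jt e e0.
exists dl => // x xt; have [Jx _] := Hdl x xt; split => //.
pose p : {poly R} := \sum_(k < K.+2) a k t *: ('X - t%:P) ^+ k.
have pE z : p.[z] = \sum_(k < K.+2) a k t * (z - t) ^+ k.
  rewrite /p horner_sum; apply: eq_bigr => k _.
  by rewrite hornerZ horner_exp hornerXsubC.
have dpE z : (deriv p).[z] = \sum_(k < K.+1) k.+1%:R * a k.+1 t * (z - t) ^+ k.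
  rewrite /p raddf_sum horner_sum big_ord_recl/= expr0 derivZ derivC scaler0 horner0 add0r.
  apply: eq_bigr => k _; rewrite /bump/= add1n derivZ deriv_exp derivXsubC mul1r.
  by rewrite hornerZ hornerMn horner_exp hornerXsubC/= -mulr_natl; ring.
pose G z := a 0%N z - p.[z].
pose dG z := 1%:R * a 1%N z - (deriv p).[z].
have GD z : J z -> is_derive z 1 G (dG z).
  by move=> Jz; exact: (is_deriveB (aT 0%N z isT Jz) (is_derive_horner p z)).
have Gt : G t = 0.
  rewrite /G pE big_ord_recl/= expr0 mulr1 big1 ?addr0 ?subrr// => k _.
  by rewrite expr0n mulr0.
have dGle z : `|z - t| < dl -> `|dG z| <= e * `|z - t| ^+ K.
  by move=> /Hdl[_]; rewrite /dG dpE.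
have step z : `|z - t| <= `|x - t| -> `|dG z * (x - t)| <= e * `|x - t| ^+ K.+1.
  move=> zx; rewrite normrM exprSr mulrA ler_wpM2r//.
  rewrite (le_trans (dGle _ _))//; first exact: le_lt_trans xt.
  by rewrite ler_wpM2l ?(ltW e0)// lerXn2r// nnegrE.
have -> : a 0%N x - \sum_(k < K.+2) a k t * (x - t) ^+ k = G x by rewrite /G pE.
have [xt0|tx0|->] := ltgtP x t.
- have [z [xz zt _]] := MVT_is_derive Jitv Jx Jt xt0 GD.
  rewrite Gt sub0r => GxE; rewrite -normrN GxE -opprB mulrN normrN step//.
  by rewrite !ler0_norm ?subr_le0 ?(ltW xt0) ?(ltW zt)// !opprB lerD2l lerN2 ltW.
- have [z [tz zx _]] := MVT_is_derive Jitv Jt Jx tx0 GD.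
  rewrite Gt subr0 => ->; rewrite step//.
  by rewrite !ger0_norm ?subr_ge0 ?(ltW tx0) ?(ltW tz)// lerD2r ltW.
- by rewrite Gt normr0 mulr_ge0 ?exprn_ge0// (ltW e0).
Qed.

End TaylorPeano.

(** * Necessity of the Hankel condition *)

Section HankelFromConvexity.
Variables (R : realType) (m : nat).
Local Notation N := m.+1.
Implicit Types (U : 'M[R[i]]_N) (d : 'rV[R]_N) (M X E : 'M[R]_N) (v : 'cV[R]_N).

Lemma convex_comb_affine (t h : R) X E U0 d0 U1 d1 U2 d2 :
  U0 \is unitarymx -> U1 \is unitarymx -> U2 \is unitarymx ->
  map_mx (real_complex R) X = rdiag U0 d0 ->
  map_mx (real_complex R) (X + E) = rdiag U1 d1 ->
  map_mx (real_complex R) (X - E) = rdiag U2 d2 ->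
  convex_comb 2^-1 U1 (\row_i (t + h * d1 0 i)) U2 (\row_i (t + h * d2 0 i))
    U0 (\row_i (t + h * d0 0 i)).
Proof.
move=> u0 u1 u2 E0 E1 E2; split; [exact: u1|exact: u2|exact: u0|].
rewrite (rdiag_affine _ _ u0 E0) (rdiag_affine _ _ u1 E1) (rdiag_affine _ _ u2 E2).
rewrite -!map_mxZ -map_mxD; congr map_mx; apply/matrixP => i j; rewrite !mxE.
move: (X i j) (E i j) (t *+ _) => x y z; lra.
Qed.

Lemma specsum_taylor (a : nat -> R -> R) K U d M v (t h e B : R) :
  U \is unitarymx -> map_mx (real_complex R) M = rdiag U d ->
  0 <= h -> 0 <= e -> (forall i, `|d 0 i| <= B) ->
  (forall x, `|x - t| <= h * B ->
    `|a 0%N x - \sum_(k < K.+1) a k t * (x - t) ^+ k| <= e * `|x - t| ^+ K) ->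
  `|specsum (a 0%N) U (\row_i (t + h * d 0 i)) (map_mx (real_complex R) v) -
    \sum_(k < K.+1) a k t * (v^T *m (h *: M) ^+ k *m v) 0 0| <=
  e * (h * B) ^+ K * (v^T *m v) 0 0.
Proof.
move=> Uu ME h0 e0 dB aP; set vC := map_mx (real_complex R) v.
have vv : (v^T *m v) 0 0 = \sum_i normsq ((U *m vC) i 0).
  have := specsum_moment v 0 Uu ME; rewrite expr0 -idmxE mulmx1 => <-.
  by apply: eq_bigr => i _; rewrite expr0 mul1r.
have mom k : (v^T *m (h *: M) ^+ k *m v) 0 0 =
    \sum_i (h * d 0 i) ^+ k * normsq ((U *m vC) i 0).
  rewrite exprZn -scalemxAr -scalemxAl [LHS]mxE -(specsum_moment v k Uu ME).
  rewrite /specsum mulr_sumr; apply: eq_bigr => i _.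
  by rewrite exprMn mulrA.
under eq_bigr do rewrite mom mulr_sumr.
rewrite exchange_big/= /specsum -sumrB vv mulr_sumr.
apply: (le_trans (ler_norm_sum _ _ _)); apply: ler_sum => i _.
rewrite (_ : _ - _ = (a 0%N (t + h * d 0 i) -
    \sum_(k < K.+1) a k t * (t + h * d 0 i - t) ^+ k) * normsq ((U *m vC) i 0)); last first.
  rewrite [(\row_ _ _) _ _]mxE mulrBl mulr_suml; congr (_ - _).
  by apply: eq_bigr => k _; rewrite addrAC subrr add0r mulrA.
have hd : `|t + h * d 0 i - t| <= h * B.
  by rewrite addrAC subrr add0r normrM (ger0_norm h0) ler_wpM2l.
rewrite normrM (ger0_norm (normsq_ge0 _)) ler_wpM2r ?normsq_ge0//.
apply: (le_trans (aP _ hd)); rewrite ler_wpM2l// lerXn2r// nnegrE//.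
exact: le_trans hd.
Qed.

(** The test vector grows at most like [h^-m] with [m = N - 1], so a Taylor remainder of order
    [h^(2N)] still leaves the factor [h^2] of a second difference. *)
Lemma scaled_col_norm (h : R) (w : 'I_N -> R) : 0 < h <= 1 ->
  h ^+ m.*2 * ((scaled_col h w)^T *m scaled_col h w) 0 0 <= \sum_i w i ^+ 2.
Proof.
move=> /andP[h0 h1]; rewrite mxE mulr_sumr; apply: ler_sum => i _.
rewrite !mxE.
have -> : h ^+ m.*2 * (h ^- i * w i * (h ^- i * w i)) =
    (h ^+ (m - i)) ^+ 2 * w i ^+ 2.
  have im : (i <= m)%N by rewrite -ltnS.
  have hE : h ^+ m = h ^+ (m - i) * h ^+ i by rewrite -exprD subnK.
  have hi0 : h ^+ i != 0 by rewrite expf_neq0// gt_eqF.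
  by rewrite -addnn exprD hE; field.
rewrite ler_piMl ?sqr_ge0// exprn_ile1 ?exprn_ge0 ?(ltW h0)//.
by rewrite exprn_ile1 ?(ltW h0).
Qed.

(** Midpoint convexity and three errors of size [r] give [A1 + A2 - 2 A0 >= -4 r]; then divide by
    [2 h2]. *)
Lemma second_difference_bound (s0 s1 s2 A0 A1 A2 r h2 Q kap : R) :
  s0 <= 2^-1 * s1 + (1 - 2^-1) * s2 ->
  `|s0 - A0| <= r -> `|s1 - A1| <= r -> `|s2 - A2| <= r ->
  A1 + A2 - 2 * A0 = 2 * h2 * Q -> r <= h2 * kap -> 0 < h2 -> 0 <= Q + 2 * kap.
Proof.
move=> cvx /ler_normlP[p0 q0] /ler_normlP[p1 q1] /ler_normlP[p2 q2] AE rk h20.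
rewrite -(pmulr_rge0 _ h20) mulrDr mulrCA; move: AE rk; rewrite -mulrA.
by set x := h2 * Q; set y := h2 * kap; lra.
Qed.

(** Midpoint convexity at [t + h X], between [t + h (X + E)] and [t + h (X - E)], is tested on
    [scaled_col h w]. The Taylor polynomial of [f] yields the second forms; its error, divided by
    [h^2], is at most [e * C] with [C] depending on neither [e] nor [h]. *)
Lemma hankel_near (J : set R) (f : R -> R) (a : nat -> R -> R) (t : R) (w : 'I_N -> R) :
  open J -> is_interval J -> taylor_family J N.*2.+1 a -> a 0%N = f ->
  spectral_convex N J f -> J t ->
  exists2 C : R, 0 <= C & forall e : R, 0 < e -> exists2 dl : R, 0 < dl &
    forall h : R, 0 < h < dl ->
      0 <= \sum_(k < N.*2.+1) a k t * second_form h w k + e * C.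
Proof.
move=> Jo Jitv aT af fcvx Jt.
pose X := jacobi R m; pose E := corner R m.
have XT : X^T = X by rewrite /X /jacobi linearD/= trmxK addrC.
have ET : E^T = E by rewrite /E /corner trmx_delta.
have [U0 [d0 [u0 E0]]] := real_sym_rdiag XT.
have [U1 [d1 [u1 E1]]] : exists U d,
    U \is unitarymx /\ map_mx (real_complex R) (X + E) = rdiag U d.
  by apply: real_sym_rdiag; rewrite linearD/= XT ET.
have [U2 [d2 [u2 E2]]] : exists U d,
    U \is unitarymx /\ map_mx (real_complex R) (X - E) = rdiag U d.
  by apply: real_sym_rdiag; rewrite linearB/= XT ET.
(* A positive bound for the eigenvalues of all three matrices. *)
pose B : R := 1 + \sum_i (`|d0 0 i| + `|d1 0 i| + `|d2 0 i|).
have dB i : [/\ `|d0 0 i| <= B, `|d1 0 i| <= B & `|d2 0 i| <= B].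
  have : `|d0 0 i| + `|d1 0 i| + `|d2 0 i| <= \sum_i (`|d0 0 i| + `|d1 0 i| + `|d2 0 i|).
    by rewrite (bigD1 i)//= lerDl sumr_ge0// => j _; rewrite !addr_ge0.
  have := normr_ge0 (d0 0 i); have := normr_ge0 (d1 0 i); have := normr_ge0 (d2 0 i).
  by rewrite /B; split; lra.
have B0 : 0 < B by rewrite /B ltr_wpDr// sumr_ge0// => j _; rewrite !addr_ge0.
pose W := \sum_i w i ^+ 2.
have W0 : 0 <= W by rewrite sumr_ge0// => i _; exact: sqr_ge0.
exists (2 * (B ^+ N.*2 * W)) => [|e e0].
  by apply: mulr_ge0 => //; apply: mulr_ge0 => //; apply: exprn_ge0; exact: ltW.
have [dl dl0 Hdl] := taylor_peano Jo Jitv aT Jt e0.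
exists (Num.min 1 (dl / B)); first by rewrite lt_min ltr01 divr_gt0.
move=> h; rewrite lt_min => /andP[h0 /andP[h1 hdl]].
have hB : h * B < dl by rewrite -ltr_pdivlMr.
have near_t x : `|x - t| <= h * B -> `|x - t| < dl by move=> /le_lt_trans; apply.
have aP x : `|x - t| <= h * B -> `|a 0%N x - \sum_(k < N.*2.+1) a k t * (x - t) ^+ k|
    <= e * `|x - t| ^+ N.*2 by move=> /near_t/Hdl[].
pose v := scaled_col h w; pose vC := map_mx (real_complex R) v.
have Jd d : (forall i, `|d 0 i| <= B) -> forall i, J ((\row_i (t + h * d 0 i)) 0 i).
  move=> dB' i; rewrite mxE; apply: (Hdl _ _).1; apply: near_t.
  by rewrite addrAC subrr add0r normrM (gtr0_norm h0) ler_wpM2l// ltW.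
have half01 : 0 <= (2^-1 : R) <= 1 by apply/andP; split; lra.
have dB0 i : `|d0 0 i| <= B by have [] := dB i.
have dB1 i : `|d1 0 i| <= B by have [] := dB i.
have dB2 i : `|d2 0 i| <= B by have [] := dB i.
have cvx := fcvx _ _ _ _ _ _ _ vC half01 (convex_comb_affine t h u0 u1 u2 E0 E1 E2)
  (Jd d1 dB1) (Jd d2 dB2).
rewrite -af in cvx.
have T0 := specsum_taylor v u0 E0 (ltW h0) (ltW e0) dB0 aP.
have T1 := specsum_taylor v u1 E1 (ltW h0) (ltW e0) dB1 aP.
have T2 := specsum_taylor v u2 E2 (ltW h0) (ltW e0) dB2 aP.
rewrite -/vC in T0 T1 T2.
have second : \sum_(k < N.*2.+1) a k t * (v^T *m (h *: (X + E)) ^+ k *m v) 0 0 +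
    \sum_(k < N.*2.+1) a k t * (v^T *m (h *: (X - E)) ^+ k *m v) 0 0 -
    2 * \sum_(k < N.*2.+1) a k t * (v^T *m (h *: X) ^+ k *m v) 0 0 =
    2 * h ^+ 2 * \sum_(k < N.*2.+1) a k t * second_form h w k.
  rewrite !mulr_sumr -big_split -sumrB/=; apply: eq_bigr => k _.
  have := jacobi_second_difference w k (lt0r_neq0 h0); rewrite -/X -/E -/v.
  rewrite mulmxBr mulmxBl mulmxDr mulmxDl.
  rewrite [(h *: X) ^+ k *+ 2]mulr2n mulmxDr mulmxDl.
  move: (v^T *m _ *m v) (v^T *m _ *m v) (v^T *m _ *m v) => r q p.
  rewrite !mxE => pqr; transitivity (a k t * (p 0 0 + q 0 0 - (r 0 0 + r 0 0))).
    by ring.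
  by rewrite pqr; ring.
have h01 : 0 < h <= 1 by rewrite h0 ltW.
have nv : h ^+ m.*2 * (v^T *m v) 0 0 <= W by exact: scaled_col_norm.
have hN : h ^+ N.*2 = h ^+ 2 * h ^+ m.*2 by rewrite -exprD.
have rE : e * (h * B) ^+ N.*2 * (v^T *m v) 0 0 <= h ^+ 2 * (e * (B ^+ N.*2 * W)).
  rewrite (_ : e * _ * _ = h ^+ 2 * (e * (B ^+ N.*2 * (h ^+ m.*2 * (v^T *m v) 0 0))));
    last by rewrite exprMn hN; ring.
  by rewrite !ler_wpM2l ?exprn_ge0 ?(ltW B0) ?(ltW e0) ?(ltW h0).
have h20 : 0 < h ^+ 2 by rewrite exprn_gt0.
rewrite (_ : e * (2 * (B ^+ N.*2 * W)) = 2 * (e * (B ^+ N.*2 * W))); last by ring.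
exact: second_difference_bound cvx T0 T1 T2 second rE h20.
Qed.

End HankelFromConvexity.

Section Hankel.
Variables (R : realType) (m : nat).
Local Notation N := m.+1.

(** The second form of index [r + 2] at 0 is the coefficient of index [r] of the square of the
    polynomial with coefficients [w]; those of index 0 and 1 are empty sums. *)
Lemma sum_cauchy_hankel (c w : nat -> R) (M : nat) (W : 'I_N -> R) : (M <= N)%N ->
  (forall i : 'I_N, W i = if (i < M)%N then w i else 0) ->
  \sum_(k < N.*2.+1) c k * second_form 0 W k =
  \sum_(i < M) \sum_(l < M) c (i + l).+2 * w i * w l.
Proof.
move=> MN WE; pose U : {poly R} := \poly_(i < M) w i.
have UE i : oapp W 0 (insub i) = U`_i.
  rewrite coef_poly; case: insubP => [j _ <-|iN] /=; first by rewrite WE.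
  by rewrite ifF//; apply/negbTE; apply: contraNN iN => /leq_trans; apply.
have UU : U * U = \sum_(i < M) \sum_(l < M) (w i * w l) *: 'X^(i + l).
  rewrite /U poly_def mulr_suml; apply: eq_bigr => i _.
  rewrite mulr_sumr; apply: eq_bigr => l _.
  by rewrite -scalerAl -scalerAr scalerA exprD.
have -> : \sum_(k < N.*2.+1) c k * second_form 0 W k =
    \sum_(r < m.*2.+1) c r.+2 * (U * U)`_r.
  rewrite doubleS 2!big_ord_recl /second_form big_ord0 mulr0 add0r.
  rewrite big_ord1 big_ord0 mulr0 add0r; apply: eq_bigr => r _.
  rewrite -/(second_form 0 W r.+2) second_form0 coefM; congr (_ * _).
  by apply: eq_bigr => i _; rewrite !UE.
rewrite UU; under eq_bigr => r _ do rewrite coef_sum mulr_sumr.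
rewrite exchange_big/=; apply: eq_bigr => -[i iM] _ /=.
under eq_bigr => r _ do rewrite coef_sum mulr_sumr.
rewrite exchange_big/=; apply: eq_bigr => -[l lM] _ /=.
have ilm : (i + l < m.*2.+1)%N.
  by rewrite -addnn; have := leq_trans iM MN; have := leq_trans lM MN; lia.
rewrite (bigD1 (Ordinal ilm))//= coefZ coefXn eqxx mulr1 big1 ?addr0 ?mulrA//.
move=> r; rewrite -val_eqE/= => /negbTE ril.
by rewrite coefZ coefXn ril !mulr0.
Qed.

(** The sum in [hankel_near] is a polynomial in [h], hence continuous at 0, where it is the Hankel
    form. *)
Lemma spectral_convex_hankel (J : set R) (f : R -> R) (a : nat -> R -> R) (t : R) :
  open J -> is_interval J -> taylor_family J N.*2.+1 a -> a 0%N = f ->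
  spectral_convex N J f -> J t -> hankel_ge0 N a t.
Proof.
move=> Jo Jitv aT af fcvx Jt M w MN.
pose W (i : 'I_N) := if (i < M)%N then w i else 0.
rewrite -(sum_cauchy_hankel (fun k => a k t) MN (fun i : 'I_N => erefl (W i))).
pose Q : {poly R} := \sum_(k < N.*2.+1)
  (a k t)%:P * second_form 'X (fun i => (W i)%:P) k.
have QE h : Q.[h] = \sum_(k < N.*2.+1) a k t * second_form h W k.
  rewrite /Q horner_sum; apply: eq_bigr => k _; rewrite hornerM hornerC; congr (_ * _).
  apply: etrans (map_second_form (horner_eval h) _ _ _) _.
  rewrite [X in second_form X](hornerX h); congr second_form.
  by apply/funext => i; exact: hornerC.
rewrite -QE; have [C C0 HC] := hankel_near W Jo Jitv aT af fcvx Jt.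
apply/ler_addgt0Pr => e e0.
(* Half of [e] pays for the error term with constant [C], half for the continuity of [Q]; [C + 1] is
   nonzero even if [C = 0]. *)
have e1 : 0 < e / 2 / (C + 1) by rewrite !divr_gt0// ltr_wpDl.
have [dl dl0 Hdl] := HC _ e1.
have Qc : {for 0, continuous (horner Q)}.
  by apply/differentiable_continuous/derivable1_diffP; exact: derivable_horner.
have e2 : 0 < e / 2 by rewrite divr_gt0.
move: Qc => /cvgrPdist_le/(_ _ e2)/nbhs_ballP[d2 /= d20 Hd2].
pose h := Num.min dl d2 / 2.
have mn0 : 0 < Num.min dl d2 by rewrite lt_min dl0.
have h0 : 0 < h by rewrite divr_gt0.
have hmin : h < Num.min dl d2 by rewrite /h; lra.
have hdl : h < dl by rewrite (lt_le_trans hmin)// ge_min lexx.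
have hd2 : h < d2 by rewrite (lt_le_trans hmin)// ge_min lexx orbT.
have Qh : `|Q.[0] - Q.[h]| <= e / 2.
  by apply: Hd2; rewrite /ball/= sub0r normrN gtr0_norm.
have := Hdl h; rewrite h0 hdl -QE => /(_ isT) Qh0.
have eC : e / 2 / (C + 1) * C <= e / 2.
  rewrite -mulrA ler_piMr// ?(ltW e2)// mulrC ler_pdivrMr ?mul1r ?lerDl//.
  by rewrite ltr_wpDl.
by move: Qh => /ler_normlP[]; lra.
Qed.

End Hankel.

(** * Steklov averages *)

Lemma antiderivative (R : realType) (f : R -> R) (al be : R) :
  (forall x, al <= x <= be -> {for x, continuous f}) ->
  exists F : R -> R, forall x, al < x < be -> is_derive x 1 F (f x).
Proof.
move=> fc; pose mu := @lebesgue_measure R.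
have fi : mu.-integrable `[al, be] (EFin \o f).
  apply: continuous_compact_integrable; first exact: segment_compact.
  apply: continuous_in_subspaceT => x; rewrite inE/= in_itv/= => xab.
  exact: fc.
exists (fun x => (\int[mu]_(t in `[al, x]) f t)%R) => x /andP[ax xb].
have fx : {for x, continuous f} by apply: fc; rewrite !ltW.
have [dF FE] := continuous_FTC1_closed xb fi ax fx.
apply: DeriveDef; first exact: dF.
exact: etrans (esym (derive1E _ _)) FE.
Qed.

Section Intervals.
Variable R : realType.
Implicit Types (I J : set R).

Lemma open_intervalU I1 I2 : open_interval I1 -> open_interval I2 ->
  I1 `&` I2 !=set0 -> open_interval (I1 `|` I2).
Proof.
move=> [i1 o1] [i2 o2] [z [z1 z2]]; split; last exact: openU.
have cross A B x y u : is_interval A -> is_interval B -> A z -> B z ->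
    A x -> B y -> x <= u <= y -> (A `|` B) u.
  move=> iA iB Az Bz Ax By /andP[xu uy]; have [uz|/ltW zu] := leP u z.
    by left; apply: (iA x z) => //; rewrite xu.
  by right; apply: (iB z y) => //; rewrite zu.
move=> x y [x1|x2] [y1|y2] u xuy.
- by left; exact: i1 xuy.
- exact: cross xuy.
- by rewrite setUC; exact: cross xuy.
- by right; exact: i2 xuy.
Qed.

(** Puts finitely many eigenvalues inside a compact interval with ends in [J], where a continuous
    function can be integrated. *)
Lemma open_interval_seq J (s : seq R) (z : R) : open J -> J z ->
  (forall x, x \in s -> J x) ->
  exists al be : R, [/\ J al, J be, al < z < be & forall x, x \in s -> al < x < be].
Proof.
move=> Jo Jz.
have ex y : J y -> exists al be : R, [/\ J al, J be & al < y < be].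
  move=> Jy; have /nbhs_ballP[d /= d0 Hd] : \forall u \near y, J u by exact: open_nbhs_nbhs.
  exists (y - d / 2), (y + d / 2).
  split; [apply: Hd|apply: Hd|]; rewrite /ball/=.
  - by rewrite opprB addrCA subrr addr0 gtr0_norm ?divr_gt0//; lra.
  - by rewrite opprD addrA subrr add0r normrN gtr0_norm ?divr_gt0//; lra.
  - by lra.
elim: s => [|x s IH] sJ.
  by have [al [be [? ? ?]]] := ex z Jz; exists al, be; split.
have sJ' u : u \in s -> J u by move=> us; apply: sJ; rewrite inE us orbT.
have [al [be [Ja Jb zab sab]]] := IH sJ'.
have [c [d [Jc Jd xcd]]] := ex x (sJ x (mem_head _ _)).
exists (Num.min al c), (Num.max be d); split.
- by rewrite minEle; case: ifP.
- by rewrite maxEle; case: ifP.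
- by rewrite gt_min lt_max; move: zab => /andP[-> ->].
- move=> u; rewrite inE gt_min lt_max => /orP[/eqP ->|/sab/andP[-> ->]//].
  by move: xcd => /andP[-> ->]; rewrite !orbT.
Qed.

End Intervals.

Section Smoothing.
Variables (R : realType) (m : nat).
Local Notation N := m.+1.

Definition smooth (K : nat) (J : set R) (f : R -> R) : Prop :=
  exists a, [/\ a 0%N = f, taylor_family J K a &
    forall x, J x -> {for x, continuous (a K)}].

Definition locality (K : nat) : Prop := forall (f : R -> R) (I1 I2 : set R),
  open_interval I1 -> open_interval I2 -> I1 `&` I2 !=set0 ->
  smooth K (I1 `|` I2) f -> spectral_convex N I1 f -> spectral_convex N I2 f ->
  spectral_convex N (I1 `|` I2) f.

Lemma taylor_family_sub (J J' : set R) K K' a : J' `<=` J -> (K' <= K)%N ->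
  taylor_family J K a -> taylor_family J' K' a.
Proof. by move=> JJ KK aT k x kK Jx; apply: aT; [exact: leq_trans KK|exact: JJ]. Qed.

(** Order [2N] suffices for [kraus_form]; the extra derivative is for the expansion to order [2N]
    behind [spectral_convex_hankel]. *)
Lemma locality_smooth : locality N.*2.+1.
Proof.
move=> f I1 I2 I1i I2i I12 [a [af aT _]] f1 f2.
have [Ji Jo] := open_intervalU I1i I2i I12.
apply: (@spectral_convex_of_kraus _ _ f (ddiff a)) => // c mu w cJ Jmu.
have aT' : taylor_family (I1 `|` I2) N.*2 a by exact: taylor_family_sub aT.
rewrite -af; apply: (kraus_form w Ji aT' _ cJ Jmu) => x [x1|x2].
  have [i o] := I1i; apply: (spectral_convex_hankel o i _ af f1 x1).
  by apply: taylor_family_sub aT => // y; left.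
have [i o] := I2i; apply: (spectral_convex_hankel o i _ af f2 x2).
by apply: taylor_family_sub aT => // y; right.
Qed.

Lemma is_derive_continuous (f : R -> R) (x d : R) :
  is_derive x 1 f d -> {for x, continuous f}.
Proof. by move=> [df _]; exact/differentiable_continuous/derivable1_diffP. Qed.

Lemma smooth_continuous K J f x : smooth K J f -> J x -> {for x, continuous f}.
Proof.
move=> [a [<- aT aK]] Jx; case: K aT aK => [_ /(_ x Jx)//|K aT _].
exact: is_derive_continuous (aT 0%N x isT Jx).
Qed.

Lemma is_derive_translate (F : R -> R) (x s l : R) :
  is_derive (x + s) 1 F l -> is_derive s 1 (fun u => F (x + u)) l.
Proof.
have E : (fun h : R => h^-1 *: (((fun u => F (x + u)) \o shift s) (h *: (1 : R)) - F (x + s)))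
    = (fun h : R => h^-1 *: ((F \o shift (x + s)) (h *: (1 : R)) - F (x + s))).
  by apply/funext => h /=; rewrite addrCA.
move=> [dF FE]; apply: DeriveDef.
  by rewrite /derivable E.
by rewrite /derive E.
Qed.

Lemma convex_comb_translate (s t : R) U d V e W c : @convex_comb R N t U d V e W c ->
  convex_comb t U (\row_i (d 0 i + s)) V (\row_i (e 0 i + s)) W (\row_i (c 0 i + s)).
Proof.
move=> [Uu Vu Wu WE]; split; [exact: Uu|exact: Vu|exact: Wu|].
have shiftE (X : 'M[R[i]]_N) (b : 'rV[R]_N) : X \is unitarymx ->
    rdiag X (\row_i (b 0 i + s)) = s%:C%:M + rdiag X b.
  move=> Xu; rewrite -[rdiag X b in RHS]scale1r.
  apply: etrans (udiag_affine (map_mx (real_complex R) b) s%:C 1 Xu).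
  rewrite /rdiag; congr udiag; apply/rowP => i.
  by rewrite [LHS]mxE [in LHS]mxE [RHS]mxE [in RHS]mxE rmorphD/= mul1r addrC.
rewrite (shiftE _ _ Uu) (shiftE _ _ Vu) (shiftE _ _ Wu) WE.
rewrite !scalerDr addrACA; congr (_ + _).
by rewrite -scalerDl rmorphB/= addrC subrK scale1r.
Qed.

(** For [F] an antiderivative of [f], the mean of [f] over [[x, x + h]]. *)
Definition steklov (F : R -> R) (h x : R) : R := (F (x + h) - F x) / h.

Lemma is_derive_specsum (F f : R -> R) (U : 'M[R[i]]_N) (d : 'rV[R]_N) v (s : R) :
  (forall i, is_derive (d 0 i + s) 1 F (f (d 0 i + s))) ->
  is_derive s 1 (fun u => specsum F U (\row_i (d 0 i + u)) v)
    (specsum f U (\row_i (d 0 i + s)) v).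
Proof.
move=> dF; rewrite /specsum; apply: is_derive_sumr => i.
have := is_deriveZ (normsq ((U *m v) i 0)) (is_derive_translate (dF i)).
rewrite [(\row_ _ _) 0 i]mxE mulrC; apply: is_derive_ext => u.
by rewrite [(\row_ _ _) 0 i]mxE [RHS]mulrC.
Qed.

Lemma specsum_steklov (F : R -> R) h (U : 'M[R[i]]_N) (d : 'rV[R]_N) v :
  specsum (steklov F h) U d v =
  (specsum F U (\row_i (d 0 i + h)) v - specsum F U (\row_i (d 0 i + 0)) v) / h.
Proof.
rewrite /specsum -sumrB mulr_suml; apply: eq_bigr => i _.
by rewrite ![(\row_ _ _) 0 i]mxE addr0 /steklov -mulrBl mulrAC.
Qed.

(** Translating all matrices by a scalar [s] preserves the convex combination, so the convexity gap
    [g s] of [f] is nonnegative for [0 <= s <= h]. The gap of the average is [(G h - G 0) / h] with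
    [G' = g], which the mean value theorem makes a value of [g]. *)
Lemma spectral_convex_steklov (I J : set R) (f F : R -> R) (h : R) : 0 < h ->
  is_interval I -> is_interval J -> spectral_convex N I f ->
  (forall x, J x -> is_derive x 1 F (f x)) ->
  spectral_convex N [set x | [/\ I x, I (x + h), J x & J (x + h)]] (steklov F h).
Proof.
move=> h0 Ii Ji fcvx Ff t U d V e W c v t01 Wc dI eI.
have cI : forall i, I (c 0 i) /\ I (c 0 i + h).
  move=> i; split.
    by apply: (convex_comb_spectrum Ii t01 Wc) => j; [have [] := dI j|have [] := eI j].
  have := convex_comb_spectrum Ii t01 (convex_comb_translate h Wc).
  by move=> /(_ _ _ i); rewrite mxE; apply=> j; rewrite mxE; [have [] := dI j|have [] := eI j].
have cJ : forall i, J (c 0 i) /\ J (c 0 i + h).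
  move=> i; split.
    by apply: (convex_comb_spectrum Ji t01 Wc) => j; [have [] := dI j|have [] := eI j].
  have := convex_comb_spectrum Ji t01 (convex_comb_translate h Wc).
  by move=> /(_ _ _ i); rewrite mxE; apply=> j; rewrite mxE; [have [] := dI j|have [] := eI j].
pose S := [set s : R | 0 <= s <= h].
have Sbetween (A : set R) x s : is_interval A -> A x -> A (x + h) -> S s -> A (x + s).
  by move=> Ai Ax Axh /andP[s0 sh]; apply: (Ai x (x + h)) => //; rewrite lerDl lerD2l s0.
pose G s := t * specsum F U (\row_i (d 0 i + s)) v
  + (1 - t) * specsum F V (\row_i (e 0 i + s)) v - specsum F W (\row_i (c 0 i + s)) v.
pose g s := t * specsum f U (\row_i (d 0 i + s)) v
  + (1 - t) * specsum f V (\row_i (e 0 i + s)) v - specsum f W (\row_i (c 0 i + s)) v.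
have Gg s : S s -> is_derive s 1 G (g s).
  move=> Ss.
  have dU : is_derive s 1 (fun u => specsum F U (\row_i (d 0 i + u)) v)
      (specsum f U (\row_i (d 0 i + s)) v).
    by apply: is_derive_specsum => i; apply: Ff; have [? ? ? ?] := dI i; exact: Sbetween.
  have dV : is_derive s 1 (fun u => specsum F V (\row_i (e 0 i + u)) v)
      (specsum f V (\row_i (e 0 i + s)) v).
    by apply: is_derive_specsum => i; apply: Ff; have [? ? ? ?] := eI i; exact: Sbetween.
  have dW : is_derive s 1 (fun u => specsum F W (\row_i (c 0 i + u)) v)
      (specsum f W (\row_i (c 0 i + s)) v).
    by apply: is_derive_specsum => i; apply: Ff; have [? ?] := cJ i; exact: Sbetween.
  exact: (is_deriveB (is_deriveD (is_deriveZ t dU) (is_deriveZ (1 - t) dV)) dW).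
have g0 s : S s -> 0 <= g s.
  move=> Ss; rewrite subr_ge0; apply: fcvx t01 (convex_comb_translate s Wc) _ _ => i.
    by rewrite mxE; have [? ? ? ?] := dI i; exact: Sbetween.
  by rewrite mxE; have [? ? ? ?] := eI i; exact: Sbetween.
have Si : is_interval S.
  move=> x y /andP[x0 xh] /andP[y0 yh] z /andP[xz zy].
  by rewrite /S/= (le_trans x0)//= (le_trans zy).
have S0 : S 0 by rewrite /S/= lexx ltW.
have Sh : S h by rewrite /S/= lexx ltW.
have [s [_ _ Ss]] := MVT_is_derive Si S0 Sh h0 Gg.
rewrite subr0 => GE; rewrite !specsum_steklov -subr_ge0.
have : 0 <= (G h - G 0) / h by rewrite GE mulr_ge0 ?invr_ge0 ?mulr_ge0 ?g0// ltW.
congr (0 <= _); rewrite /G; field; exact: lt0r_neq0.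
Qed.

Lemma smooth_steklov K (J J' : set R) (f F : R -> R) (h : R) : 0 < h ->
  smooth K J f -> J' `<=` J -> (forall x, J' x -> is_derive x 1 F (f x)) ->
  smooth K.+1 [set x | J' x /\ J' (x + h)] (steklov F h).
Proof.
move=> h0 [a [af aT aK]] JJ Ff.
(* The derivative of the average is the difference quotient of [f]; normalizing its [k']-th
   derivative by [(k' + 1)!] leaves the factor [k' + 1]. *)
pose b k := if k is k'.+1 then fun x => (h * k'.+1%:R)^-1 * (a k' (x + h) - a k' x)
  else steklov F h.
have tr (p : R -> R) x l : is_derive (x + h) 1 p l -> is_derive x 1 (fun u => p (u + h)) l.
  move=> pl; apply: (@is_derive_ext _ (fun u => p (h + u))).
    by move=> u; rewrite addrC.
  by apply: is_derive_translate; rewrite addrC.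
exists b; split => //.
  move=> [|k] x kK [Jx Jxh] /=.
    rewrite mul1r mulr1 af.
    have := is_deriveZ h^-1 (is_deriveB (tr _ _ _ (Ff _ Jxh)) (Ff _ Jx)).
    by apply: is_derive_ext => u; rewrite /steklov [RHS]mulrC.
  have := is_deriveZ (h * k.+1%:R)^-1
    (is_deriveB (tr _ _ _ (aT k _ kK (JJ _ Jxh))) (aT k x kK (JJ _ Jx))).
  rewrite (_ : _ *: _ = k.+2%:R * ((h * k.+2%:R)^-1 * (a k.+1 (x + h) - a k.+1 x)))//.
  rewrite -mulrBr /GRing.scale/=.
  have k1 : k.+1%:R != 0 :> R by rewrite pnatr_eq0.
  have k2 : k.+2%:R != 0 :> R by rewrite pnatr_eq0.
  move: k1 k2 (lt0r_neq0 h0); move: (k.+1%:R : R) (k.+2%:R : R) => p q p0 q0 h0'.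
  by field; rewrite p0 q0 h0'.
move=> x [Jx Jxh] /=; apply: (@continuousM R R).
  exact: cst_continuous.
apply: (@continuousB R R R); last exact: aK (JJ _ Jx).
apply: continuous_comp; last exact: aK (JJ _ Jxh).
by apply: continuousD; [exact: cvg_id|exact: cst_continuous].
Qed.

Lemma smooth_sub K (J J' : set R) f : J' `<=` J -> smooth K J f -> smooth K J' f.
Proof.
move=> JJ [a [af aT aK]]; exists a; split=> //; last by move=> x /JJ; exact: aK.
exact: taylor_family_sub aT.
Qed.

Lemma steklov_cvg (F : R -> R) (x l : R) : is_derive x 1 F l ->
  steklov F h x @[h --> 0^'+] --> l.
Proof.
move=> [dF <-]; apply: cvg_dnbhs_at_right; rewrite /derive.
have -> : (fun h => steklov F h x) =
    (fun h : R => h^-1 *: ((F \o shift x) (h *: (1 : R)) - F x)).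
  apply/funext => h; rewrite /steklov /= [RHS]mulrC; congr ((F _ - _) / _).
  by rewrite addrC [_ *: _]mulr1.
exact: dF.
Qed.

Lemma specsum_steklov_cvg (F f : R -> R) (U : 'M[R[i]]_N) (d : 'rV[R]_N) v :
  (forall i, is_derive (d 0 i) 1 F (f (d 0 i))) ->
  specsum (steklov F h) U d v @[h --> 0^'+] --> specsum f U d v.
Proof.
move=> dF; rewrite /specsum; elim: (index_enum _) => [|i s IH].
  rewrite big_nil (_ : (fun _ => _) = (fun=> 0)); first exact: cvg_cst.
  by apply/funext => h; rewrite big_nil.
rewrite big_cons (_ : (fun _ => _) = (fun h => steklov F h (d 0 i) * normsq ((U *m v) i 0) +
    \sum_(j <- s) steklov F h (d 0 j) * normsq ((U *m v) j 0))); last first.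
  by apply/funext => h; rewrite big_cons.
apply: cvgD; last exact: IH.
apply: cvgM; [exact: steklov_cvg|exact: cvg_cst].
Qed.

Definition translate_core (I J : set R) (h : R) : set R :=
  [set x | [/\ I x, I (x + h), J x & J (x + h)]].

Lemma open_interval_translate_core (I J : set R) h :
  open_interval I -> open_interval J -> open_interval (translate_core I J h).
Proof.
move=> [Ii Io] [Ji Jo]; split.
  move=> x y [Ix Ixh Jx Jxh] [Iy Iyh Jy Jyh] z /andP[xz zy].
  split; [apply: (Ii x y)|apply: (Ii (x + h) (y + h))|apply: (Ji x y)|
    apply: (Ji (x + h) (y + h))] => //; by rewrite ?lerD2r xz zy.
have -> : translate_core I J h =
    (I `&` (fun x => x + h) @^-1` I) `&` (J `&` (fun x => x + h) @^-1` J).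
  by apply/seteqP; split=> x; [move=> []|move=> [[? ?] [? ?]]].
have tr (A : set R) : open A -> open ((fun x => x + h) @^-1` A).
  apply: open_comp => x _.
  by apply: continuousD; [exact: cvg_id|exact: cst_continuous].
by apply: openI; apply: openI => //; exact: tr.
Qed.

Lemma near_translate_core (I J : set R) x : open I -> open J -> I x -> J x ->
  \forall h \near 0^'+, translate_core I J h x.
Proof.
move=> Io Jo Ix Jx.
have tr (A : set R) : open A -> A x -> \forall h \near 0^'+, A (x + h).
  move=> Ao Ax.
  have /nbhs_ballP[d /= d0 Hd] : \forall u \near x, A u by exact: open_nbhs_nbhs.
  near=> h; apply: Hd; rewrite /ball/= opprD addrA subrr sub0r normrN.
  by rewrite gtr0_norm//; near: h; exact: nbhs_right_lt.
near=> h; split=> //; near: h; exact: tr.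
Unshelve. all: by end_near. Qed.

(** The matrices are fixed first, so only finitely many eigenvalues matter. For small [h] those of
    the two end matrices lie in the union of the two cores, where the smoother average satisfies the
    inequality; then [h] tends to 0 from the right. *)
Lemma locality_step K : locality K.+1 -> locality K.
Proof.
move=> loc f I1 I2 I1i I2i [z [z1 z2]] fS f1 f2 t U d V e W c v t01 Wc dI eI.
have [Ji Jo] : open_interval (I1 `|` I2) by apply: open_intervalU => //; exists z.
have cI := convex_comb_spectrum Ji t01 Wc.
pose s := codom (d 0) ++ codom (e 0) ++ codom (c 0).
have [||al [be [Ja Jb zab sab]]] := @open_interval_seq _ (I1 `|` I2) s z Jo.
- by left.
- by move=> x; rewrite !mem_cat => /or3P[] /codomP[i ->]; [exact: dI|exact: eI|exact: cI].
have dab i : al < d 0 i < be by apply: sab; rewrite !mem_cat codom_f.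
have eab i : al < e 0 i < be by apply: sab; rewrite !mem_cat codom_f orbT.
have cab i : al < c 0 i < be by apply: sab; rewrite !mem_cat codom_f !orbT.
have [x xab|F Ff] := @antiderivative _ f al be.
  by apply: (smooth_continuous fS); exact: (Ji al be).
pose AB := [set x : R | al < x < be].
have ABi : open_interval AB.
  split.
    move=> x y /andP[ax _] /andP[_ yb] u /andP[xu uy].
    by rewrite /AB/= (lt_le_trans ax)// (le_lt_trans uy).
  have -> : AB = [set x | al < x] `&` [set x | x < be].
    by apply/seteqP; split=> x /=; [move=> /andP[]|move=> [ax xb]; apply/andP].
  by apply: openI; [exact: open_gt|exact: open_lt].
have ABJ : AB `<=` I1 `|` I2.
  by move=> x /andP[ax xb]; apply: (Ji al be) => //; rewrite !ltW.
pose core I h := translate_core I AB h.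
have near_core x : (I1 `|` I2) x -> AB x ->
    \forall h \near 0^'+, (core I1 h `|` core I2 h) x.
  move=> [x1|x2] xAB.
    have [_ o] := I1i; near=> h; left; near: h; apply: near_translate_core => //.
    by have [] := ABi.
  have [_ o] := I2i; near=> h; right; near: h; apply: near_translate_core => //.
  by have [] := ABi.
have ineq : \forall h \near 0^'+,
    0 <= t * specsum (steklov F h) U d v + (1 - t) * specsum (steklov F h) V e v
      - specsum (steklov F h) W c v.
  near=> h.
  have h0 : 0 < h by near: h; exact: nbhs_right_gt.
  have core_cvx I : is_interval I -> spectral_convex N I f ->
      spectral_convex N (core I h) (steklov F h).
    by move=> Ii fI; apply: spectral_convex_steklov fI _ => //; have [] := ABi.
  rewrite subr_ge0.
  apply: (loc _ (core I1 h) (core I2 h) _ _ _ _ _ _ _ _ _ _ _ _ _ _ t01 Wc).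
  - exact: open_interval_translate_core.
  - exact: open_interval_translate_core.
  (* The common point [z] was placed between [al] and [be], so the cores still meet. *)
  - exists z; split; near: h; apply: near_translate_core => //.
    + by have [] := I1i.
    + by have [] := ABi.
    + by have [] := I2i.
    + by have [] := ABi.
  - apply: (@smooth_sub _ [set x | AB x /\ AB (x + h)]).
      by move=> x [] [].
    exact: (smooth_steklov h0 fS ABJ).
  - by apply: core_cvx => //; have [] := I1i.
  - by apply: core_cvx => //; have [] := I2i.
  - by near: h; apply: filter_forall => i; apply: near_core; [exact: dI|exact: dab].
  - by near: h; apply: filter_forall => i; apply: near_core; [exact: eI|exact: eab].
rewrite -subr_ge0; apply: (cvgr_to_ge _ ineq).
apply: cvgB; last by apply: specsum_steklov_cvg => i; exact: Ff.
apply: cvgD; apply: cvgM; (exact: cvg_cst || (apply: specsum_steklov_cvg => i; exact: Ff)).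
Unshelve. all: by end_near. Qed.

Lemma locality_continuous : locality 0.
Proof.
have loc j K : (K + j)%N = N.*2.+1 -> locality K.
  elim: j K => [|j IH] K; first by rewrite addn0 => ->; exact: locality_smooth.
  by rewrite addnS -addSn => /IH; exact: locality_step.
exact: (loc N.*2.+1).
Qed.

(** * Continuity of [n]-convex functions, and the conclusion *)

Lemma scalar_convex (I : set R) f (x y t : R) : spectral_convex N I f ->
  I x -> I y -> 0 <= t <= 1 -> f (t * x + (1 - t) * y) <= t * f x + (1 - t) * f y.
Proof.
move=> fcvx Ix Iy t01.
have u1 : (1%:M : 'M[R[i]]_N) \is unitarymx.
  by apply/unitarymxP; rewrite mul1mx trmx1 map_mx1.
have Wc : convex_comb t 1%:M (const_mx x) 1%:M (const_mx y) (1%:M : 'M[R[i]]_N)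
    (const_mx (t * x + (1 - t) * y)).
  split; [exact: u1|exact: u1|exact: u1|].
  rewrite !(rdiag_const _ u1) !scale_scalar_mx -raddfD; congr (_%:M).
  by rewrite rmorphD !rmorphM.
have := fcvx _ _ _ _ _ _ _ (delta_mx 0 0) t01 Wc.
have cE g (u : R) : specsum g 1%:M (const_mx u : 'rV[R]_N) (delta_mx 0 0) = g u.
  rewrite /specsum mul1mx (bigD1 0)//= [const_mx _ _ _]mxE [delta_mx _ _ _ _]mxE !eqxx/=.
  rewrite big1 ?addr0; first by rewrite /normsq/= expr1n expr0n addr0 mulr1.
  by move=> j j0; rewrite [delta_mx _ _ _ _]mxE (negbTE j0)/= /normsq/= expr0n/= addr0 mulr0.
by rewrite !cE; apply => i; rewrite mxE.
Qed.

(** Scalar convexity is enough: the chord from [x] to [x + s] bounds [f (x + u s)] above, and the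
    chord from [x + u s] to [x - s], which passes over [x], bounds it below. Both deviations are at
    most [u * C]. *)
Lemma spectral_convex_continuous (I : set R) f x : open I ->
  spectral_convex N I f -> I x -> {for x, continuous f}.
Proof.
move=> Io fcvx Ix.
have /nbhs_ballP[d /= d0 Hd] : \forall u \near x, I u by exact: open_nbhs_nbhs.
pose r := d / 2; have r0 : 0 < r by rewrite divr_gt0.
have Ir u : `|u| <= r -> I (x + u).
  move=> ur; apply: Hd; rewrite /ball/= opprD addrA subrr sub0r normrN.
  by rewrite (le_lt_trans ur)// /r; lra.
pose C := `|f (x + r) - f x| + `|f (x - r) - f x|.
have C0 : 0 <= C by rewrite addr_ge0.
have bound (s u : R) : `|s| = r -> 0 <= u <= 1 -> `|f (x + u * s) - f x| <= u * C.
  move=> sr /andP[u0 u1].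
  have Is : I (x + s) by apply: Ir; rewrite sr.
  have Ims : I (x - s) by apply: Ir; rewrite normrN sr.
  have Ius : I (x + u * s) by apply: Ir; rewrite normrM sr (ger0_norm u0) ler_piMl// ltW.
  have sC : `|f (x + s) - f x| <= C /\ `|f (x - s) - f x| <= C.
    have [s0|s0] := leP 0 s.
      by move: sr; rewrite ger0_norm// => ->; rewrite /C lerDl lerDr.
    have -> : s = - r by rewrite -sr ltr0_norm// opprK.
    by rewrite /C opprK lerDl lerDr.
  have up : f (x + u * s) <= u * f (x + s) + (1 - u) * f x.
    rewrite (_ : x + u * s = u * (x + s) + (1 - u) * x); last by ring.
    by apply: scalar_convex fcvx Is Ix _; rewrite u0.
  have u1p : 0 < 1 + u by rewrite ltr_wpDr.
  have u1n := lt0r_neq0 u1p.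
  (* [x] combines [x + u s] and [x - s] with weights [1 / (1 + u)] and [u / (1 + u)]. *)
  have lo : (1 + u) * f x <= f (x + u * s) + u * f (x - s).
    have t01 : 0 <= (1 + u)^-1 <= 1 by rewrite invr_ge0 (ltW u1p) invf_le1// lerDl.
    have := ler_wpM2l (ltW u1p) (scalar_convex fcvx Ius Ims t01).
    rewrite (_ : _ * (x + u * s) + _ = x); last by field.
    by rewrite (_ : (1 + u) * (_ + _) = f (x + u * s) + u * f (x - s)); last by field.
  have m1 := ler_wpM2l u0 (le_trans (ler_norm _) sC.1).
  have m2 := ler_wpM2l u0 (le_trans (ler_norm _) sC.2).
  by apply/ler_normlP; split; lra.
apply/cvgrPdist_le => e e0.
have C10 : 0 < C + 1 by rewrite ltr_wpDl.
pose q := Num.min 1 (e / (C + 1)).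
have q0 : 0 < q by rewrite lt_min ltr01 divr_gt0.
apply/nbhs_ballP; exists (r * q) => /=; first by rewrite mulr_gt0.
move=> y; rewrite /ball/= => xy.
have uq : `|x - y| / r < q by rewrite ltr_pdivrMr// mulrC.
have u0 : 0 <= `|x - y| / r by rewrite divr_ge0// ltW.
have u1 : `|x - y| / r <= 1 by rewrite (le_trans (ltW uq))// ge_min lexx.
have ue : `|x - y| / r * C <= e.
  apply: (@le_trans _ _ (e / (C + 1) * C)).
    by rewrite ler_wpM2r// (le_trans (ltW uq))// ge_min lexx orbT.
  by rewrite -mulrA ler_piMr ?(ltW e0)// mulrC ler_pdivrMr// mul1r lerDl.
rewrite distrC; apply: le_trans ue.
(* Signed so that [y = x + u * sg] with [u = |x - y| / r]. *)
pose sg : R := if x <= y then r else - r.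
have sgr : `|sg| = r by rewrite /sg; case: ifP => _; rewrite ?normrN gtr0_norm.
rewrite {1}(_ : y = x + `|x - y| / r * sg); first by apply: bound; rewrite ?u0.
rewrite /sg; case: leP => xy'.
  by rewrite distrC ger0_norm ?subr_ge0// divfK ?gt_eqF// addrC subrK.
by rewrite ger0_norm ?subr_ge0 ?(ltW xy')// mulrN divfK ?gt_eqF// opprB addrC subrK.
Qed.

End Smoothing.

Theorem corollary9 (R : realType) (n : nat) (I1 I2 : set R) (f : R -> R)
    (n_gt0 : (0 < n)%N)
    (I1_itv : open_interval I1) (I2_itv : open_interval I2)
    (I12 : I1 `&` I2 !=set0)
    (f1 : matrix_convex n I1 f) (f2 : matrix_convex n I2 f) :
  matrix_convex n (I1 `|` I2) f.
Proof.
case: n n_gt0 f1 f2 => [//|m] _ /matrix_convexP f1 /matrix_convexP f2.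
apply/matrix_convexP; apply: locality_continuous => //.
(* For [K = 0], smoothness only asks for continuity of the coefficient of index 0; the other
   coefficients are filled with 0. *)
exists (fun k => if k is 0%N then f else fun=> 0); split=> // x [x1|x2].
  by have [_ o] := I1_itv; exact: spectral_convex_continuous o f1 x1.
by have [_ o] := I2_itv; exact: spectral_convex_continuous o f2 x2.
Qed.
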